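(* Let $q_0=(x_0,y_0,z_0,w_0)\in\mathbb{R}^4$ and $q_1=(x_1,y_1,z_1,w_1)\in\mathbb{R}^4$. Assume that $z_1-z_0=J_F(x_0,y_0)+J_F(x_1,-y_1)$ and $w_1-w_0\ge T_F(x_0,y_0)+T_F(x_1,-y_1)$. Put $t_1=w_1-w_0$ and let $(x_F(t),y_F(t))$ with control $u_F(t)$, $t\in[0,t_1]$, be an optimal trajectory in the finite-time Fuller problem $$\frac12\int_0^{t_1}x^2\,dt\to\min,\quad \dot x=y,\ \dot y=u,\ |u|\le 1,\quad x(0)=x_0,\ y(0)=y_0,\ x(t_1)=x_1,\ y(t_1)=y_1.$$ Put $$z_F(t)=z_0+\frac12\int_0^t x_F^2(s)\,ds,\qquad w_F(t)=w_0+t,\qquad v_F(t)\equiv 1.$$ Then the trajectory $(x_F(t),y_F(t),z_F(t),w_F(t))$ with controls $(u_F(t),v_F(t))$, $t\in[0,t_1]$, is the unique shortest path connecting $q_0$ to $q_1$ in the sub-Finsler structure on $\mathbb{R}^4$ described in the context, i.e. the unique solution of the time-optimal problem $$T\to\min;\quad \dot x=yv,\ \dot y=u,\ \dot z=\tfrac12x^2v,\ \dot w=v,\quad |u|\le1,\ |v|\le 1,\quad (x,y,z,w)(0)=q_0,\ (x,y,z,w)(T)=q_1.$$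
   Context: Fuller problem: for $(x_0,y_0)\in\mathbb{R}^2$, minimize $\frac12\int_0^{+\infty}x^2\,dt$ subject to $\dot x=y$, $\dot y=u$, $|u|\le1$, $x(0)=x_0$, $y(0)=y_0$ (measurable control $u$). It is known that for each $(x_0,y_0)$ there is a unique optimal trajectory $(x(t),y(t),u(t))$, and there is a finite time $T_F(x_0,y_0)\ge 0$ such that $x(t)=y(t)=u(t)=0$ for all $t\ge T_F(x_0,y_0)$ while $|u(t)|=1$ for almost all $t\in[0,T_F(x_0,y_0)]$. This defines $T_F$. Define $$J_F(x_0,y_0)=\inf\Big\{\tfrac12\int_0^\infty x^2\,dt\ \Big|\ x(0)=x_0,\ \dot x(0)=y_0,\ |\ddot x|\le1\Big\}.$$ Sub-Finsler structure: on $\mathbb{R}^4=\{q=(x,y,z,w)\}$ let $f_1(q)=(y,0,\frac12x^2,1)$ and $f_2(q)=(0,1,0,0)$. The unit ball in $T_q\mathbb{R}^4$ is $B(q)=\mathrm{conv}(\pm f_1(q)\pm f_2(q))$ (all four sign choices), and $\|\xi\|=\inf\{a\ge0:\xi\in aB(q)\}\in\mathbb{R}\cup\{+\infty\}$ (with $\inf\emptyset=+\infty$). The length of an absolutely continuous curve is $\int\|\dot q\|\,dt$, and the sub-Finsler distance is the infimum of lengths of curves connecting two points, equivalently the infimum of times $T$ for which there is a curve with $\|\dot q\|\le1$ a.e., $q(0)=q_0$, $q(T)=q_1$. Shortest paths are considered in this time-optimal (natural) parameterization, with $\dot q=vf_1(q)+uf_2(q)$, $|u|\le1$, $|v|\le1$.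 *)

(* Defs.v *)
(* MathComp-Analysis; the reals are an arbitrary [R : realType]. *)
From HB Require Import structures.
From mathcomp Require Import all_boot all_order all_algebra.
From mathcomp Require Import all_classical all_reals all_analysis.

Set Implicit Arguments.
Unset Strict Implicit.
Unset Printing Implicit Defensive.
Import Order.TTheory GRing.Theory Num.Theory.
Import numFieldNormedType.Exports.

Local Open Scope classical_set_scope.
Local Open Scope ring_scope.

Section AbsolutelyContinuous.
Context {R : realType}.

Definition abs_cont (a b : R) (f : R -> R) : Prop :=
  forall e : R, 0 < e -> exists2 d : R, 0 < d &
    forall (n : nat) (l r : 'I_n -> R),
      (forall i, a <= l i <= r i /\ r i <= b) ->
      trivIset [set: 'I_n] (fun i => `]l i, r i[%classic) ->
      \sum_(i < n) (r i - l i) < d ->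
      \sum_(i < n) `|f (r i) - f (l i)| < e.

(* Caratheodory sense of the differential equation [f' = g] on [0, T]. *)
Definition ac_deriv (T : R) (f g : R -> R) : Prop :=
  abs_cont 0 T f /\
  {ae (@lebesgue_measure R), forall t : R, 0 < t < T -> is_derive t 1 f (g t)}.

End AbsolutelyContinuous.

Section Fuller.
Context {R : realType}.

Definition fuller_traj (T x0 y0 : R) (x y u : R -> R) : Prop :=
  [/\ measurable_fun `[0, T] u,
      forall t, 0 <= t <= T -> `|u t| <= 1,
      ac_deriv T x y, ac_deriv T y u & x 0 = x0 /\ y 0 = y0].

Definition fuller_cost (D : set R) (x : R -> R) : \bar R :=
  (2^-1%:E * \int[@lebesgue_measure R]_(t in D) ((x t) ^+ 2)%:E)%E.

Definition fuller_feasible (T x0 y0 x1 y1 : R) (x y u : R -> R) : Prop :=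
  fuller_traj T x0 y0 x y u /\ x T = x1 /\ y T = y1.

Definition fuller_optimal (T x0 y0 x1 y1 : R) (x y u : R -> R) : Prop :=
  fuller_feasible T x0 y0 x1 y1 x y u /\
  forall x' y' u', fuller_feasible T x0 y0 x1 y1 x' y' u' ->
    (fuller_cost `[0%R, T] x <= fuller_cost `[0%R, T] x')%E.

Definition fuller_inf_traj (x0 y0 : R) (x y u : R -> R) : Prop :=
  forall T, 0 <= T -> fuller_traj T x0 y0 x y u.

Definition fuller_inf_optimal (x0 y0 : R) (x y u : R -> R) : Prop :=
  fuller_inf_traj x0 y0 x y u /\
  forall x' y' u', fuller_inf_traj x0 y0 x' y' u' ->
    (fuller_cost `[0%R, +oo[ x <= fuller_cost `[0%R, +oo[ x')%E.

Definition J_F (x0 y0 : R) : \bar R :=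
  ereal_inf [set c | exists x y u : R -> R,
    fuller_inf_traj x0 y0 x y u /\ c = fuller_cost `[0%R, +oo[ x].

(* The graph of the partial function T_F: [is_T_F x0 y0 T] reads
   "T = T_F(x0, y0)".  At most one [T] satisfies it, since the optimal
   trajectory is unique and [u] cannot be both 0 and of modulus 1. *)
Definition is_T_F (x0 y0 T : R) : Prop :=
  0 <= T /\ exists x y u : R -> R,
    [/\ fuller_inf_optimal x0 y0 x y u,
        forall t, T <= t -> [/\ x t = 0, y t = 0 & u t = 0] &
        {ae (@lebesgue_measure R),
          forall t : R, 0 <= t <= T -> `|u t| = 1}].

End Fuller.

Section SubFinsler.
Context {R : realType}.
Notation point := 'rV[R]_4.
Notation mu := (@lebesgue_measure R).

Definition pt (x y z w : R) : point := \row_(j < 4) [:: x; y; z; w]`_j.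

Definition f1 (q : point) : point := pt (q 0 1) 0 (2^-1 * (q 0 0) ^+ 2) 1.
Definition f2 (q : point) : point := pt 0 1 0 0.

Definition conv_hull (I : finType) (p : I -> point) : set point :=
  [set b | exists c : I -> R, [/\ forall i, 0 <= c i, \sum_i c i = 1 &
    b = \sum_i c i *: p i]].

Definition sf_ball (q : point) : set point :=
  conv_hull (fun s : bool * bool => (-1) ^+ s.1 *: f1 q + (-1) ^+ s.2 *: f2 q).

Definition sf_norm (q xi : point) : \bar R :=
  ereal_inf [set a%:E | a in
    [set a : R | 0 <= a /\ exists2 b, sf_ball q b & xi = a *: b]].

Definition velocity (c : R -> point) (t : R) : point :=
  \row_(j < 4) derive1 (fun s => c s 0 j) t.

(* Absolutely continuous curve on [0, T] joining [q0] to [q1].  The almost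
   everywhere differentiability contained in [ac_deriv] is no restriction: it
   follows from absolute continuity by Lebesgue's theorem. *)
Definition ac_curve (q0 q1 : point) (T : R) (c : R -> point) : Prop :=
  [/\ 0 <= T,
      forall j, ac_deriv T (fun t => c t 0 j) (fun t => velocity c t 0 j) &
      c 0 = q0 /\ c T = q1].

Definition sf_length (T : R) (c : R -> point) : \bar R :=
  (\int[mu]_(t in `[0%R, T]) sf_norm (c t) (velocity c t))%E.

Definition sf_dist (q0 q1 : point) : \bar R :=
  ereal_inf [set l | exists (T : R) (c : R -> point),
    ac_curve q0 q1 T c /\ l = sf_length T c].

(* Shortest path in natural parametrization. *)
Definition sf_shortest (q0 q1 : point) (T : R) (c : R -> point) : Prop :=
  [/\ ac_curve q0 q1 T c,
      {ae mu, forall t : R, 0 < t < T ->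
        (sf_norm (c t) (velocity c t) <= 1%:E)%E} &
      T%:E = sf_dist q0 q1].

Definition control_traj (q0 q1 : point) (T : R) (c : R -> point)
    (u v : R -> R) : Prop :=
  [/\ 0 <= T, measurable_fun `[0, T] u /\ measurable_fun `[0, T] v,
      forall t, 0 <= t <= T -> `|u t| <= 1 /\ `|v t| <= 1,
      forall j, ac_deriv T (fun t => c t 0 j)
        (fun t => (v t *: f1 (c t) + u t *: f2 (c t)) 0 j) &
      c 0 = q0 /\ c T = q1].

Definition time_optimal (q0 q1 : point) (T : R) (c : R -> point)
    (u v : R -> R) : Prop :=
  control_traj q0 q1 T c u v /\
  forall T' c' u' v', control_traj q0 q1 T' c' u' v' -> T <= T'.

End SubFinsler.

(* Main.v *)
Require Import Defs.
From HB Require Import structures.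
From mathcomp Require Import all_boot all_order all_algebra.
From mathcomp Require Import all_classical all_reals all_analysis.
From mathcomp Require Import measurable_realfun ring lra.
Import Order.TTheory GRing.Theory Num.Theory.
Import numFieldNormedType.Exports.
Set Implicit Arguments.
Unset Strict Implicit.
Unset Printing Implicit Defensive.
Local Open Scope classical_set_scope.
Local Open Scope ring_scope.

(** Write X(t) = xa(t) + xb(t1 - t), where xa and xb are the optimal solutions
    of the infinite-horizon problem issued from (x0, y0) and (x1, -y1).  They
    vanish after TF0 and TF1, and TF0 + TF1 <= t1, so the two summands are
    never nonzero at the same time: X runs along xa into the origin, rests
    there, and leaves it along xb reversed in time.  It is feasible for the
    problem on [0, t1] ([concatenation_feasible]) and costs
    J_F(x0, y0) + J_F(x1, -y1) ([concatenation_cost]).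

    X is the only minimizer, by convexity.  Let x be feasible on [0, t1].
    Steered to the origin after t1 ([fuller_traj_steer]), it competes with xa,
    and so does every convex combination of the two; hence the integral of
    xa (x - xa) is nonnegative ([fuller_inf_first_order]).  What happens after
    t1 does not enter, because xa is zero there.  Time reversal gives the same
    for xb.  As the supports are disjoint, the two inequalities add up to the
    first-order condition for X, and expanding the square,
      int x^2 >= int X^2 + int (x - X)^2   ([concatenation_gap]).
    So a feasible x whose cost does not exceed z1 - z0 equals X; this applies
    to xF, whose cost is therefore exactly z1 - z0.

    In the sub-Finsler structure the unit ball at q is the set of all
    v f1(q) + u f2(q) with |u|, |v| <= 1 ([sf_ballP]), so the norm of a
    velocity dominates |dw/dt| and no curve from q0 to q1 is shorter than
    w1 - w0 = t1 ([sf_length_ge]).  The lift of xF has speed at most 1 and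
    reaches q1 at time t1 because xF costs z1 - z0; it is thus a shortest path.
    Conversely a path of duration t1 must have dw/dt = 1 almost everywhere;
    then it projects to an admissible trajectory on [0, t1] with cost z1 - z0,
    which is xF ([curve_rigidity]).

    Absolute continuity is handled through one tool, the mean value
    inequality [ac_mean_value]: an absolutely continuous function whose
    derivative is at most M almost everywhere grows at rate at most M. *)

(** * Mean value inequality for absolutely continuous functions *)

(** Real induction: the supremum of the t with P a t cannot be smaller than b,
    since P holds across a whole neighbourhood of it. *)
Lemma segment_induction (R : realType) (a b : R) (P : R -> R -> Prop) :
  a <= b ->
  (forall s r t, a <= s -> s <= r -> r <= t -> t <= b ->
     P s r -> P r t -> P s t) ->
  (forall c, a <= c <= b -> exists2 e : R, 0 < e & forall s t,
     a <= s -> s <= c -> c <= t -> t <= b -> c - e < s -> t < c + e -> P s t) ->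
  P a b.
Proof.
move=> ab Ptr Ploc.
pose S := [set t | [/\ a <= t, t <= b & P a t]].
have Sa : S a.
  split => //; have [|e e0 Pe] := Ploc a; first by rewrite lexx.
  by apply: Pe => //; lra.
have Sb : ubound S b by move=> t [].
have hS : has_sup S by split; [exists a | exists b].
pose c := sup S.
have ac : a <= c by apply: ub_le_sup => //; exists b.
have cb : c <= b by apply: ge_sup => //; exists a.
have [|e e0 Pe] := Ploc c; first by rewrite ac.
have [t St ct] := sup_adherent e0 hS; rewrite -/c in ct.
have tc : t <= c by apply: ub_le_sup => //; exists b.
have [at_ tb Pt] := St.
pose t' := Num.min b (c + e / 2).
have t'b : t' <= b by rewrite ge_min lexx.
have t'ce : t' <= c + e / 2 by rewrite ge_min lexx orbT.
have ct' : c <= t' by rewrite le_min cb/=; lra.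
have Pt' : P a t'.
  by apply: (Ptr a t t') => //; [lra|apply: Pe => //; lra].
have : t' <= c.
  by apply: ub_le_sup; [exists b | split => //; lra].
have [<-//|cne] := eqVneq t' b.
by rewrite {1}/t' /Num.min; case: ifP => [bc|_]; [rewrite /t' /Num.min bc eqxx in cne | lra].
Qed.

(** Lists can be concatenated, which families indexed by ordinals cannot; this
    transfers absolute continuity to lists of successive intervals. *)
Lemma abs_cont_seq (R : realType) (a b : R) (f : R -> R) (e d : R)
    (L : seq (R * R)) :
  (forall (n : nat) (l r : 'I_n -> R),
      (forall i, a <= l i <= r i /\ r i <= b) ->
      trivIset [set: 'I_n] (fun i => `]l i, r i[%classic) ->
      \sum_(i < n) (r i - l i) < d ->
      \sum_(i < n) `|f (r i) - f (l i)| < e) ->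
  all (fun p => (a <= p.1 <= p.2) && (p.2 <= b)) L ->
  pairwise (fun p q => p.2 <= q.1) L ->
  \sum_(p <- L) (p.2 - p.1) < d ->
  \sum_(p <- L) `|f p.2 - f p.1| < e.
Proof.
move=> H La Lp; rewrite (big_nth (0, 0)) big_mkord => Ld.
rewrite (big_nth (0, 0)) big_mkord.
apply: (H _ (fun i : 'I_(size L) => (nth (0,0) L i).1)
            (fun i : 'I_(size L) => (nth (0,0) L i).2)) => //.
  move=> i; have := all_nthP (0,0) La i (ltn_ord i).
  by move=> /andP[-> ->].
move=> i j _ _ [x [/=]]; rewrite !in_itv/= => /andP[x1 x2] /andP[x3 x4].
have /(pairwiseP (0,0)) Lp' := Lp.
apply/val_inj; case: (ltngtP (val i) (val j)) => // ij.
- have h := Lp' i j (ltn_ord i) (ltn_ord j) ij.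
  by have := lt_trans (lt_le_trans x2 h) x3; rewrite ltxx.
- have h := Lp' j i (ltn_ord j) (ltn_ord i) ij.
  by have := lt_trans (lt_le_trans x4 h) x1; rewrite ltxx.
Qed.

Lemma is_derive_cvg (R : realType) (f : R -> R) (c l : R) :
  is_derive c 1 f l -> h^-1 *: (f (h + c) - f c) @[h --> (0:R)^'] --> l.
Proof.
move=> [df dfl].
rewrite -dfl; have : cvg ((fun h => h^-1 *: ((f \o shift c) (h *: (1:R)) - f c)) @ (0:R)^') by exact: df.
rewrite /derive; set g := fun h => _; set g' := fun h => _.
by have -> : g' = g by apply/funext => h; rewrite /g /g'/= [h%:A]mulr1.
Qed.

(** A derivative below M only controls increments that straddle the point,
    which is exactly the local step of [segment_induction]. *)
Lemma is_derive_growth (R : realType) (f : R -> R) (c l M : R) :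
  is_derive c 1 f l -> l < M ->
  exists2 e : R, 0 < e & forall s t, s <= c -> c <= t -> c - e < s ->
    t < c + e -> f t - f s <= M * (t - s).
Proof.
move=> [df dfl] lM.
have cv := is_derive_cvg (DeriveDef df dfl).
have /= := cvgr_lt l cv _ lM.
case=> e /= e0 He; exists e => // s t sc ct es te.
have Hl : f c - f s <= M * (c - s).
  have [->|scn] := eqVneq s c; first lra.
  have := He (s - c); rewrite /ball_/= subrK sub0r normrN ler0_norm; last lra.
  have sc' : s < c by rewrite lt_neqAle scn.
  move=> /(_ ltac:(lra)) /(_ ltac:(by rewrite subr_eq0)).
  rewrite /GRing.scale/= mulrC ltr_ndivrMr; lra.
have Hr : f t - f c <= M * (t - c).
  have [->|tcn] := eqVneq t c; first lra.
  have := He (t - c); rewrite /ball_/= subrK sub0r normrN ger0_norm; last lra.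
  have tc' : c < t by rewrite lt_neqAle eq_sym tcn.
  move=> /(_ ltac:(lra)) /(_ ltac:(by rewrite subr_eq0)).
  rewrite /GRing.scale/= mulrC ltr_pdivrMr; lra.
lra.
Qed.

Lemma ae_imply (R : realType) (P Q : R -> Prop) :
  {ae (@lebesgue_measure R), forall t, P t} -> (forall t, P t -> Q t) ->
  {ae (@lebesgue_measure R), forall t, Q t}.
Proof.
move=> HP PQ; apply: filterS HP; first exact: (ae_filter_ringOfSetsType (@lebesgue_measure R)).
exact: PQ.
Qed.

Lemma ae_imply2 (R : realType) (P Q S : R -> Prop) :
  {ae (@lebesgue_measure R), forall t, P t} ->
  {ae (@lebesgue_measure R), forall t, Q t} ->
  (forall t, P t -> Q t -> S t) ->
  {ae (@lebesgue_measure R), forall t, S t}.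
Proof.
move=> HP HQ PQ; apply: filterS2 HP HQ; first exact: (ae_filter_ringOfSetsType (@lebesgue_measure R)).
exact: PQ.
Qed.

Lemma ae_neq (R : realType) (a : R) :
  {ae (@lebesgue_measure R), forall t, t != a}.
Proof.
exists [set a]; split; [exact: measurable_set1|exact: lebesgue_measure_set1|].
by move=> t /= /negP; rewrite negbK => /eqP.
Qed.

Lemma ae_closed_itv (R : realType) (a b : R) (P : R -> Prop) :
  {ae (@lebesgue_measure R), forall t, a < t < b -> P t} ->
  {ae (@lebesgue_measure R), forall t, a <= t <= b -> P t}.
Proof.
move=> H.
apply: (ae_imply2 H (ae_imply2 (ae_neq a) (ae_neq b) (fun t => @conj _ _))).
move=> t Ht [ta tb] /andP[at_ tb']; apply: Ht.
by rewrite !lt_neqAle at_ tb' eq_sym ta tb.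
Qed.

(** Turns the almost everywhere filter into an explicit Borel null set. *)
Lemma ae_null_set (R : realType) (P : R -> Prop) :
  {ae (@lebesgue_measure R), forall t, P t} ->
  exists N : set R, [/\ measurable N, lebesgue_measure N = 0%E &
    forall t, ~ N t -> P t].
Proof.
move=> [N [mN N0 subN]]; exists N; split => // t Nt.
by apply: contrapT => Pt; apply: Nt; exact: subN.
Qed.

Lemma null_set_open_cover (R : realType) (N : set R) (d : R) :
  measurable N -> lebesgue_measure N = 0%E -> 0 < d ->
  exists U : set R, [/\ open U, N `<=` U & (lebesgue_measure U < d%:E)%E].
Proof.
pose mu : {measure set (measurableTypeR R) -> \bar R} := @lebesgue_measure R.
rewrite -[lebesgue_measure N]/(mu N) => mN N0 d0.
have [|U [oU NU muU]] := @lebesgue_regularity_outer R N d mN _ d0.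
  by rewrite -[X in (X < _)%E]/(mu N) N0 ltry.
exists U; split => //; rewrite -[lebesgue_measure U]/(mu U).
have mU : measurable U by exact: open_measurable.
rewrite -(setUIDK U N); apply: le_lt_trans (measureU2 _ _ _) _.
- exact: measurableI.
- exact: measurableD.
- by rewrite (subset_measure0 _ _ _ N0) ?add0e//; exact: measurableI.
Qed.

Lemma lebesgue_measure_split (R : realType) (U : set R) (s r t : R) :
  open U -> s <= r -> r <= t ->
  lebesgue_measure (U `&` `]s, t]%classic) =
  (lebesgue_measure (U `&` `]s, r]%classic) +
   lebesgue_measure (U `&` `]r, t]%classic))%E.
Proof.
pose mu : {measure set (measurableTypeR R) -> \bar R} := @lebesgue_measure R.
move=> oU sr rt; have mU : measurable U by exact: open_measurable.
rewrite (@itv_bndbnd_setU _ _ _ (BRight r)) ?bnd_simp// setIUr.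
apply: (@measureU _ _ _ mu); try exact: measurableI.
apply/seteqP; split => // x [[_ /=]].
by rewrite in_itv/= => /andP[_ xr] [_ /=]; rewrite in_itv/= ltNge xr.
Qed.

(** Cover the exceptional null set by an open U of small measure and argue by
    real induction.  Near a point outside U the derivative bounds the increment;
    near a point of U the increment is charged to an interval contained in U.
    The charged intervals have total length at most the measure of U, so
    absolute continuity makes their total contribution arbitrarily small. *)
Lemma ac_mean_value (R : realType) (a b : R) (f : R -> R) (M : R) :
  a <= b -> abs_cont a b f ->
  {ae (@lebesgue_measure R), forall t : R, a < t < b ->
     exists2 l, is_derive t 1 f l & l <= M} ->
  f b - f a <= M * (b - a).
Proof.
move=> ab acf /ae_closed_itv/ae_null_set[N [mN N0 HN]].
suff H : forall e : R, 0 < e -> f b - f a <= (M + e) * (b - a) + 2 * e.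
  apply/ler_addgt0Pr => e e0.
  have e1 : 0 < e / (b - a + 2) by rewrite divr_gt0//; lra.
  have := H _ e1.
  rewrite (_ : (M + _) * _ + 2 * _ = M * (b - a) + e)//.
  by field; apply/eqP; lra.
move=> e e0; have [d d0 Hd] := acf e e0.
pose K := `|M|; have K0 : 0 <= K by exact: normr_ge0.
have KM : - M <= K by rewrite /K -normrN ler_norm.
(* M may be negative: on the intervals inside U the term (M + e) (t - s) is
   compensated by K times their length, which the second bound keeps below e. *)
pose d' := Num.min d (e / (K + 1)).
have d'0 : 0 < d' by rewrite lt_min d0 divr_gt0//; lra.
have [U [oU NU muU]] := null_set_open_cover mN N0 d'0.
have mU : measurable U by exact: open_measurable.
pose V s t : set R := U `&` `]s, t]%classic.
have mV s t : measurable (V s t) by apply: measurableI.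
(* L lists the intervals charged to U between s and t. *)
pose P s t := exists L : seq (R * R),
  [/\ all (fun p => (s <= p.1 <= p.2) && (p.2 <= t)) L,
      pairwise (fun p q => p.2 <= q.1) L,
      ((\sum_(p <- L) (p.2 - p.1))%:E <= lebesgue_measure (V s t))%E &
      f t - f s <= (M + e) * (t - s) + \sum_(p <- L) `|f p.2 - f p.1| +
        K * \sum_(p <- L) (p.2 - p.1)].
have [L [La Lp Ld Lf]] : P a b.
  apply: segment_induction => //.
  - move=> s r t as_ sr rt tb [L1 [La1 Lp1 Ld1 Lf1]] [L2 [La2 Lp2 Ld2 Lf2]].
    exists (L1 ++ L2); split.
    + rewrite all_cat; apply/andP; split.
        apply: sub_all La1 => p /andP[-> pr]; exact: le_trans pr rt.
      apply: sub_all La2 => p /andP[/andP[rp ->] ->].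
      by rewrite (le_trans sr rp).
    + rewrite pairwise_cat Lp1 Lp2 !andbT.
      apply/allrelP => p q /(allP La1) /andP[_ pr] /(allP La2) /andP[/andP[rq _] _].
      exact: le_trans pr rq.
    + rewrite /V (lebesgue_measure_split oU sr rt).
      by rewrite big_cat/= EFinD leeD.
    + by rewrite !big_cat/=; lra.
  - move=> c /andP[ac cb]; have [Uc|Uc] := pselect (U c).
      have /nbhs_ballP[r /= r0 rU] : nbhs c U by exact: open_nbhs_nbhs.
      exists r => // s t as_ sc ct tb rs tr; exists [:: (s, t)].
      have st : s <= t by exact: le_trans ct.
      split; rewrite ?big_seq1//=.
      * by rewrite st !lexx.
      * have -> : V s t = `]s, t]%classic.
          apply: setIidr => x /=; rewrite in_itv/= => /andP[sx xt].
          apply: rU; rewrite /ball/= ltr_distlC; apply/andP; split; lra.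
        rewrite lebesgue_measure_itv/= lte_fin; case: ltP => [_|ts]//.
        by rewrite lee_fin; lra.
      * have := ler_norm (f t - f s).
        have : 0 <= (M + K + e) * (t - s) by apply: mulr_ge0; lra.
        lra.
    have [|l fl lM] := HN c (fun Nc => Uc (NU _ Nc)); first by rewrite ac.
    have [|r r0 Hr] := is_derive_growth fl (_ : l < M + e); first lra.
    exists r => // s t _ sc ct _ rs tr; exists [::]; split => //.
    + by rewrite big_nil measure_ge0.
    + by rewrite !big_nil mulr0 !addr0; exact: Hr.
have Ld' : \sum_(p <- L) (p.2 - p.1) < d'.
  rewrite -lte_fin; apply: le_lt_trans Ld _; apply: le_lt_trans muU.
  by apply: (@le_measure _ _ _ (@lebesgue_measure R)); rewrite ?inE//; [exact: mV|exact: subIsetl].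
have [Ld1 Ld2] : \sum_(p <- L) (p.2 - p.1) < d /\
    \sum_(p <- L) (p.2 - p.1) < e / (K + 1).
  by move: Ld'; rewrite lt_min => /andP[].
have LK : K * \sum_(p <- L) (p.2 - p.1) <= e.
  have : K * \sum_(p <- L) (p.2 - p.1) <= K * (e / (K + 1)).
    by rewrite ler_wpM2l// ltW.
  move=> /le_trans; apply; rewrite mulrA ler_pdivrMr; nra.
have := abs_cont_seq Hd La Lp Ld1; lra.
Qed.

(** * Calculus of almost everywhere derivatives *)

Lemma abs_cont_sub (R : realType) (a b a' b' : R) (f : R -> R) :
  a <= a' -> b' <= b -> abs_cont a b f -> abs_cont a' b' f.
Proof.
move=> aa bb H e e0; have [d d0 Hd] := H e e0; exists d => // n l r lr.
apply: Hd => i; have [/andP[h1 h2] h3] := lr i.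
by rewrite (le_trans aa h1) h2 (le_trans h3 bb).
Qed.

Lemma eq_abs_cont (R : realType) (a b : R) (f g : R -> R) :
  (forall t, a <= t <= b -> f t = g t) -> abs_cont a b f -> abs_cont a b g.
Proof.
move=> fg H e e0; have [d d0 Hd] := H e e0; exists d => // n l r lr tr lrd.
have := Hd n l r lr tr lrd.
congr (_ < _); apply: eq_bigr => i _; have [/andP[h1 h2] h3] := lr i.
by rewrite !fg// ?h1 ?(le_trans h1 h2) ?(le_trans h2 h3).
Qed.

Lemma abs_contD (R : realType) (a b : R) (f g : R -> R) :
  abs_cont a b f -> abs_cont a b g -> abs_cont a b (fun t => f t + g t).
Proof.
move=> Hf Hg e e0; have e2 : 0 < e / 2 by rewrite divr_gt0.
have [d d0 Hd] := Hf _ e2; have [d' d'0 Hd'] := Hg _ e2.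
exists (Num.min d d'); first by rewrite lt_min d0.
move=> n l r lr tr; rewrite lt_min => /andP[ld ld'].
have h1 := Hd n l r lr tr ld; have h2 := Hd' n l r lr tr ld'.
apply: le_lt_trans (_ : \sum_(i < n) (`|f (r i) - f (l i)| +
  `|g (r i) - g (l i)|) < e); last by rewrite big_split/=; lra.
apply: ler_sum => i _; apply: le_trans (ler_normD _ _).
by rewrite opprD addrACA.
Qed.

Lemma lipschitz_abs_cont (R : realType) (a b K : R) (f : R -> R) :
  (forall s t, a <= s -> s <= t -> t <= b -> `|f t - f s| <= K * (t - s)) ->
  abs_cont a b f.
Proof.
move=> H e e0; pose K' := `|K| + 1.
have K'0 : 0 < K' by rewrite /K' ltr_wpDl.
exists (e / K'); first exact: divr_gt0.
move=> n l r lr _; rewrite ltr_pdivlMr// mulrC mulr_sumr; apply: le_lt_trans.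
apply: ler_sum => i _; have [/andP[h1 h2] h3] := lr i.
apply: le_trans (H _ _ h1 h2 h3) _; rewrite ler_wpM2r ?subr_ge0//.
by rewrite (le_trans (ler_norm K))// /K' lerDl.
Qed.

Lemma abs_cont_comp_lipschitz (R : realType) (a b K : R) (f h : R -> R) :
  abs_cont a b f ->
  (forall s t, a <= s <= b -> a <= t <= b ->
     `|h (f t) - h (f s)| <= K * `|f t - f s|) ->
  abs_cont a b (h \o f).
Proof.
move=> Hf H e e0; pose K' := `|K| + 1.
have K'0 : 0 < K' by rewrite /K' ltr_wpDl.
have eK : 0 < e / K' by exact: divr_gt0.
have [d d0 Hd] := Hf _ eK; exists d => // n l r lr tr ld.
have := Hd n l r lr tr ld; rewrite ltr_pdivlMr// mulrC mulr_sumr; apply: le_lt_trans.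
apply: ler_sum => i _; have [/andP[h1 h2] h3] := lr i.
apply: le_trans (H _ _ _ _) _; rewrite ?h1 ?(le_trans h1 h2) ?h3 ?(le_trans h2 h3)//.
rewrite ler_wpM2r//.
by rewrite (le_trans (ler_norm K))// /K' lerDl.
Qed.

Lemma abs_contZ (R : realType) (a b c : R) (f : R -> R) :
  abs_cont a b f -> abs_cont a b (fun t => c * f t).
Proof.
move=> Hf; apply: (@abs_cont_comp_lipschitz _ _ _ `|c| f (fun x => c * x)) => //.
by move=> s t _ _; rewrite -mulrBr normrM.
Qed.

Lemma abs_contB (R : realType) (a b : R) (f g : R -> R) :
  abs_cont a b f -> abs_cont a b g -> abs_cont a b (fun t => f t - g t).
Proof.
move=> Hf Hg; apply: eq_abs_cont (abs_contD Hf (abs_contZ (-1) Hg)) => t _.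
by rewrite mulN1r.
Qed.

Lemma abs_cont_cst (R : realType) (a b c : R) : abs_cont a b (fun=> c).
Proof.
by apply: (@lipschitz_abs_cont _ _ _ 0) => *; rewrite subrr normr0 mul0r.
Qed.

Lemma abs_cont_modulus (R : realType) (a b : R) (f : R -> R) (e : R) :
  abs_cont a b f -> 0 < e -> exists2 d : R, 0 < d & forall s t,
    a <= s <= b -> a <= t <= b -> `|t - s| < d -> `|f t - f s| < e.
Proof.
move=> Hf e0; have [d d0 Hd] := Hf _ e0; exists d => // s t.
wlog st : s t / s <= t.
  move=> H hs ht; case: (leP s t) => [|/ltW] st; first exact: H.
  by rewrite distrC (distrC (f t)); exact: H.
move=> /andP[as_ sb] /andP[at_ tb]; rewrite ger0_norm ?subr_ge0// => std.
have := Hd 1%N (fun=> s) (fun=> t); rewrite !big_ord1; apply => //.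
- by move=> _; rewrite as_ st.
- by move=> i j _ _ _; rewrite !ord1.
Qed.

Lemma abs_cont_continuous (R : realType) (a b : R) (f : R -> R) :
  abs_cont a b f -> {within `[a, b], continuous f}.
Proof.
move=> Hf; apply/subspace_continuousP => x /=; rewrite in_itv/= => xab.
apply/cvgrPdist_lt => e e0; have [d d0 Hd] := abs_cont_modulus Hf e0.
rewrite near_withinE; apply: filterS (nbhsx_ballx x _ d0) => y yx.
rewrite /= in_itv/= => yab; rewrite distrC; apply: Hd => //.
by rewrite distrC.
Qed.

Section AcDeriv.
Context {R : realType}.
Implicit Types (T K c : R) (f g h : R -> R).
Local Notation mu := (@lebesgue_measure R).

Lemma ac_deriv_sub T T' f g : T' <= T -> ac_deriv T f g -> ac_deriv T' f g.
Proof.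
move=> TT [Hf Hg]; split; first exact: abs_cont_sub Hf.
apply: (ae_imply Hg) => t H /andP[t0 tT]; apply: H.
by rewrite t0 (lt_le_trans tT).
Qed.

Lemma ac_deriv_cst T c : ac_deriv T (fun=> c) (fun=> 0).
Proof.
by split; [exact: abs_cont_cst|apply: aeW => t _; exact: is_derive_cst].
Qed.

Lemma ac_derivD T f g f' g' : ac_deriv T f g -> ac_deriv T f' g' ->
  ac_deriv T (fun t => f t + f' t) (fun t => g t + g' t).
Proof.
move=> [Hf Hg] [Hf' Hg']; split; first exact: abs_contD.
apply: (ae_imply2 Hg Hg') => t H H' tT.
by apply: is_deriveD; [exact: H|exact: H'].
Qed.

Lemma ac_derivZ T c f g : ac_deriv T f g ->
  ac_deriv T (fun t => c * f t) (fun t => c * g t).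
Proof.
move=> [Hf Hg]; split; first exact: abs_contZ.
by apply: (ae_imply Hg) => t H tT; apply: is_deriveZ; exact: H.
Qed.

Lemma ac_derivB T f g f' g' : ac_deriv T f g -> ac_deriv T f' g' ->
  ac_deriv T (fun t => f t - f' t) (fun t => g t - g' t).
Proof.
move=> [Hf Hg] [Hf' Hg']; split; first exact: abs_contB.
apply: (ae_imply2 Hg Hg') => t H H' tT.
by apply: is_deriveB; [exact: H|exact: H'].
Qed.

Lemma ac_derivN T f g : ac_deriv T f g ->
  ac_deriv T (fun t => - f t) (fun t => - g t).
Proof.
move=> /(ac_derivB (ac_deriv_cst T 0)) [Hf Hg]; split.
  by apply: eq_abs_cont Hf => t _; rewrite sub0r.
apply: (ae_imply Hg) => t + tT => /(_ tT).
by rewrite sub0r; under eq_fun do rewrite sub0r.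
Qed.

Lemma eq_ac_deriv T f f' g g' : (forall t, 0 <= t <= T -> f t = f' t) ->
  {ae mu, forall t, 0 < t < T -> g t = g' t} ->
  ac_deriv T f g -> ac_deriv T f' g'.
Proof.
move=> ff' gg' [Hf Hg]; split; first exact: eq_abs_cont Hf.
apply: (ae_imply2 gg' Hg) => t eg H tT; rewrite -eg//.
apply: near_eq_is_derive (H tT); have /andP[t0 tT'] := tT.
have tT2 : t \in `]0, T[ by rewrite in_itv/=.
apply: filterS (near_in_itvoo tT2) => s; rewrite in_itv/= => /andP[s0 sT].
by apply: ff'; rewrite !ltW.
Qed.

Lemma ac_deriv_ge T f g K a b : ac_deriv T f g ->
  {ae mu, forall t, 0 < t < T -> g t <= K} ->
  0 <= a -> a <= b -> b <= T -> f b - f a <= K * (b - a).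
Proof.
move=> [Hf Hg] gK a0 ab bT; apply: ac_mean_value => //.
  exact: abs_cont_sub Hf.
apply: (ae_imply2 Hg gK) => t H H' /andP[at_ tb].
by exists (g t); [apply: H|apply: H'];
  rewrite (le_lt_trans a0 at_) (lt_le_trans tb bT).
Qed.

Lemma ac_deriv_lipschitz T f g K a b : ac_deriv T f g ->
  {ae mu, forall t, 0 < t < T -> `|g t| <= K} ->
  0 <= a -> a <= b -> b <= T -> `|f b - f a| <= K * (b - a).
Proof.
move=> Hf gK a0 ab bT; rewrite ler_norml lerNl opprB; apply/andP; split.
  have gK' : {ae mu, forall t, 0 < t < T -> - g t <= K}.
    apply: (ae_imply gK) => t H /H; apply: le_trans.
    by rewrite -normrN ler_norm.
  have := ac_deriv_ge (ac_derivN Hf) gK' a0 ab bT.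
  by rewrite opprK addrC.
apply: (ac_deriv_ge Hf _ a0 ab bT).
by apply: (ae_imply gK) => t H /H; apply: le_trans; exact: ler_norm.
Qed.

(** The difference has derivative zero almost everywhere, hence is
    0-Lipschitz; this is where absolute continuity cannot be dropped. *)
Lemma ac_deriv_unique T f f' g : ac_deriv T f g -> ac_deriv T f' g ->
  f 0 = f' 0 -> forall t, 0 <= t <= T -> f t = f' t.
Proof.
move=> Hf Hf' f0 t /andP[t0 tT].
have gg : {ae mu, forall s, 0 < s < T -> `|g s - g s| <= 0}.
  by apply: aeW => s _; rewrite subrr normr0.
have := ac_deriv_lipschitz (ac_derivB Hf Hf') gg (lexx 0) t0 tT.
by rewrite mul0r normr_le0 f0 subrr subr0 subr_eq0 => /eqP.
Qed.

(** Lebesgue measure is determined by its values on half-open intervals, and its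
    image under a reflection has the same values there. *)
Lemma negligible_reflect T (A : set R) : mu.-negligible A ->
  mu.-negligible [set t | A (T - t)].
Proof.
move=> [N [mN N0 AN]].
have mphi : measurable_fun setT ((fun t => T - t) : R -> measurableTypeR R).
  by apply: continuous_measurable_fun => t; apply: cvgB; [exact: cvg_cst|exact: cvg_id].
exists ((fun t => T - t) @^-1` N); split.
- by rewrite -[X in measurable X]setTI; exact: mphi.
- have <- : lebesgue_measure N = 0%E by [].
  symmetry.
  apply: (@lebesgue_measure_unique R (pushforward mu ((fun t => T - t) : R -> measurableTypeR R))) => //.
  move=> _ [[a b] _ <-].
  rewrite [RHS](_ : _ = mu `[T - b, T - a[%classic); last first.
    rewrite /pushforward; congr (mu _); apply/seteqP.
    by split => x /=; rewrite !in_itv/= => /andP[h1 h2]; apply/andP; split; lra.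
  rewrite /= !lebesgue_measure_itv/= !lte_fin.
  rewrite ltrD2l ltrN2; case: ifP => // _.
  rewrite -!EFinB; congr (_%:E); lra.
- by move=> t; exact: AN.
Qed.

Lemma ae_reflect T (P : R -> Prop) : {ae mu, forall t, P t} ->
  {ae mu, forall t, P (T - t)}.
Proof. exact: negligible_reflect. Qed.

Lemma abs_cont_reflect T f : abs_cont 0 T f -> abs_cont 0 T (fun t => f (T - t)).
Proof.
move=> H e e0; have [d d0 Hd] := H e e0; exists d => // n l r lr tr.
move=> lrd; under eq_bigr do rewrite distrC.
apply: (Hd n (fun i => T - r i) (fun i => T - l i)).
- move=> i; have [/andP[h1 h2] h3] := lr i; split; last lra.
  by apply/andP; split; lra.
- move=> i j _ _ [x [/=]]; rewrite !in_itv/= => /andP[h1 h2] /andP[h3 h4].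
  apply: tr => //; exists (T - x) => /=; rewrite !in_itv/=; split; apply/andP; split; lra.
- rewrite (eq_bigr (fun i => r i - l i))// => i _; ring.
Qed.

Lemma ac_deriv_reflect T f g : ac_deriv T f g ->
  ac_deriv T (fun t => f (T - t)) (fun t => - g (T - t)).
Proof.
move=> [Hf Hg]; split; first exact: abs_cont_reflect.
apply: (ae_imply (ae_reflect T Hg)) => t H /andP[t0 tT].
have {}H : is_derive (T - t) 1 f (g (T - t)) by apply: H; apply/andP; split; lra.
rewrite -[X in is_derive _ _ _ X]mulrN1.
apply: (@is_derive1_comp _ f (fun t => T - t)).
rewrite -[X in is_derive _ _ _ X]sub0r; exact: is_deriveB.
Qed.

End AcDeriv.

(** * Measurable derivatives and their integrals *)

Section Clamp.
Context {R : realType}.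
Implicit Types (T : R) (f g : R -> R).
Local Notation mu := (@lebesgue_measure R).

(** Composing with the retraction of the line onto [0, T] extends a function on
    [0, T] to a continuous one on the line. *)
Definition clamp T (t : R) : R := Num.max 0 (Num.min t T).

Lemma clamp_id T t : 0 <= t <= T -> clamp T t = t.
Proof.
by move=> /andP[t0 tT]; rewrite /clamp (min_idPl tT) (max_idPr t0).
Qed.

Lemma clamp_itv T t : 0 <= T -> 0 <= clamp T t <= T.
Proof. by move=> T0; rewrite /clamp le_max lexx /= ge_max T0 ge_min lexx orbT. Qed.

Lemma clamp_lipschitz T s t : `|clamp T t - clamp T s| <= `|t - s|.
Proof.
rewrite /clamp /Num.max /Num.min; case: ifP; case: ifP; case: ifP; case: ifP => *;
  rewrite ler_norml ?opprB; apply/andP; split;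
  have := ler_norm (t - s); have := ler_norm (s - t); rewrite (distrC s t); lra.
Qed.

Lemma clamp_continuous T f : 0 <= T -> abs_cont 0 T f ->
  continuous (f \o clamp T).
Proof.
move=> T0 Hf t; apply/cvgrPdist_lt => e e0.
have [d d0 Hd] := abs_cont_modulus Hf e0.
apply: filterS (nbhsx_ballx t _ d0) => s ts /=.
apply: Hd; rewrite ?clamp_itv//.
exact: le_lt_trans (clamp_lipschitz _ _ _) _.
Qed.

End Clamp.

Section MeasurableDerivative.
Context {R : realType}.
Implicit Types (T : R) (f g : R -> R).
Local Notation mu := (@lebesgue_measure R).

(** The derivative is a limit of continuous difference quotients, hence Borel
    off a null set.  The last conclusion makes g comparable to the actual
    derivative at every point, so that it can serve as a measurable minorant. *)
Lemma abs_cont_measurable_derivative T f : 0 <= T -> abs_cont 0 T f ->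
  {ae mu, forall t, 0 < t < T -> derivable f t 1} ->
  exists g : R -> R, [/\ measurable_fun setT g,
    {ae mu, forall t, 0 < t < T -> is_derive t 1 f (g t)} &
    forall t, g t = 0 \/ (0 < t < T /\ is_derive t 1 f (g t))].
Proof.
move=> T0 Hf /ae_null_set[N [mN N0 HN]].
pose E : set R := `]0, T[%classic `\` N.
have mE : measurable E by apply: measurableD.
have HE t : E t -> is_derive t 1 f ('D_1 f t).
  move=> [/=]; rewrite in_itv/= => t0T Nt.
  by apply: DeriveDef => //; exact: HN.
pose g : R -> R := (fun t => 'D_1 f t) \_ E.
have gE t : E t -> g t = 'D_1 f t by move=> Et; rewrite /g patchE mem_set.
pose D n : R -> R := fun t => n.+1%:R * ((f \o clamp T) (t + n.+1%:R^-1) - (f \o clamp T) t).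
have cf := clamp_continuous T0 Hf.
have mD n : measurable_fun setT (D n).
  apply: continuous_measurable_fun => t; apply: cvgM; first exact: cvg_cst.
  apply: cvgB; last exact: cf.
  have : {for t, continuous ((f \o clamp T) \o (fun t => t + n.+1%:R^-1))}.
    apply: continuous_comp; last exact: cf.
    by apply: cvgD; [exact: cvg_id|exact: cvg_cst].
  exact.
exists g; split.
- apply: (@measurable_fun_cvg _ _ _ setT (fun n => D n \_ E)).
    by move=> n; apply/(measurable_restrictT _ mE); exact: measurable_funS (mD n).
  move=> t _; have [Et|Et] := pselect (E t); last first.
    rewrite /g patchE memNset//.
    rewrite (_ : (fun n => _) = (fun=> 0)); first exact: cvg_cst.
    by apply/funext => n; rewrite patchE memNset.
  rewrite gE//.
  rewrite (_ : (fun n => _) = (fun n => D n t)); last first.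
    by apply/funext => n; rewrite patchE mem_set.
  have [] := Et; rewrite /= in_itv/= => /andP[t0 tT] _.
  apply/cvgrPdist_lt => e e0.
  have /cvgrPdist_lt/(_ e e0)/= := is_derive_cvg (HE _ Et).
  case=> d /= d0 Hd.
  have Tt : 0 < T - t by lra.
  near=> n.
  have n0 : 0 < n.+1%:R^-1 :> R by rewrite invr_gt0.
  have nd : n.+1%:R^-1 < d by near: n; exact: near_infty_natSinv_lt (PosNum d0).
  have nT : n.+1%:R^-1 < T - t by near: n; exact: near_infty_natSinv_lt (PosNum Tt).
  have := Hd n.+1%:R^-1; rewrite /ball_/= sub0r normrN gtr0_norm//.
  move=> /(_ nd); rewrite gt_eqF// => /(_ isT); rewrite /D/= !clamp_id.
  - by rewrite invrK /GRing.scale/= (addrC t).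
  - by rewrite ltW// ltW.
  - by rewrite addr_ge0 ?(ltW t0) ?(ltW n0)//= -lerBrDl (ltW nT).
- exists N; split => // t /= H; apply: contrapT => Nt; apply: H => t0T.
  have Et : E t by split => //=; rewrite in_itv.
  by rewrite gE//; exact: HE.
- move=> t; have [Et|Et] := pselect (E t); last by left; rewrite /g patchE memNset.
  right; rewrite gE//; split; last exact: HE.
  by have [] := Et; rewrite /= in_itv.
Unshelve. all: by end_near. Qed.

End MeasurableDerivative.

Section IntegralOfDerivative.
Context {R : realType}.
Implicit Types (T : R) (f g : R -> R).
Local Notation mu := (@lebesgue_measure R).

Lemma lebesgue_measure_oo_le (l r : R) : l <= r ->
  (lebesgue_measure `]l, r[%classic <= (r - l)%:E)%E.
Proof.
move=> lr; rewrite lebesgue_measure_itv/= lte_fin; case: ltP => // _.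
by rewrite lee_fin subr_ge0.
Qed.

(** The derivative is the Lebesgue differentiation theorem; absolute continuity
    is that of the integral of |g| with respect to the measure of the domain. *)
Lemma ac_integral T g : 0 <= T -> mu.-integrable `[0, T] (EFin \o g) ->
  ac_deriv T (fun t => \int[mu]_(s in `[0, t]) g s) g.
Proof.
move=> T0 ig; pose h : R -> R := g \_ `[0, T].
have hE t : 0 <= t <= T -> h t = g t by move=> tT; rewrite /h patchE mem_set//= in_itv.
have ih : mu.-integrable setT (EFin \o h).
  by rewrite -restrict_EFin; apply/integrable_restrict => //=; rewrite setTI.
have ihA (A : set R) : measurable A -> mu.-integrable A (EFin \o h).
  by move=> mA; apply: integrableS ih.
have Hd : ac_deriv T (fun t => \int[mu]_(s in `[0, t]) h s) h.
  split.
  - move=> e e0.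
    have [d [d0 Hd]] := integral_normr_continuous ih e0.
    exists d => // n l r lr tr lrd.
    pose A := \big[setU/set0]_(i < n) `]l i, r i[%classic.
    have mA : measurable A by apply: bigsetU_measurable.
    have muA : (mu A < d%:E)%E.
      rewrite /A (@measure_bigsetU_ord _ _ _ (@lebesgue_measure R))//.
      apply: le_lt_trans (_ : ((\sum_(i < n) (r i - l i))%:E < _)%E); last by rewrite lte_fin.
      rewrite -sumEFin; apply: lee_sum => i _.
      by have [/andP[_ lri] _] := lr i; exact: lebesgue_measure_oo_le.
    have := Hd A mA muA; apply: le_lt_trans.
    have ihn (B : set R) : measurable B -> mu.-integrable B (fun x => `|h x|%:E).
      by move=> mB; exact: (integrable_abse (ihA B mB)).
    have FE i : `|\int[mu]_(s in `[0, r i]) h s - \int[mu]_(s in `[0, l i]) h s| <=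
        fine (\int[mu]_(s in `]l i, r i[) `|h s|%:E).
      have [/andP[li lri] _] := lr i.
      rewrite Rintegral_itvB ?bnd_simp//; last exact: ihA.
      apply: le_trans (le_normr_Rintegral _ _) _ => //; first exact: ihA.
      by rewrite -Rintegral_itv_bndo_bndc//; exact: ihn.
    apply: le_trans (ler_sum _ (fun i _ => FE i)) _.
    rewrite sum_fine; last by move=> i _; apply: integrable_fin_num => //; exact: ihn.
    rewrite /Rintegral /A ge0_integral_bigsetU//.
    + exact: index_enum_uniq.
    + exact: sub_trivIset tr.
    + by have /integrableP[] := ihn _ mA.
  - have lh : locally_integrable setT h by exact: integrable_locally.
    have := @FTC1 R h (BLeft 0) (fun y => ihA _ (measurable_itv _)) lh.
    move=> /= H0; apply: (ae_imply H0) => t H /andP[t0 tT].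
    have [] := H _; first by rewrite lte_fin.
    by rewrite derive1E => dF dFE; exact: DeriveDef.
apply: eq_ac_deriv Hd.
  move=> t /andP[t0 tT]; apply: eq_Rintegral => s; rewrite inE/= in_itv/= => /andP[s0 st].
  by apply: hE; rewrite s0 (le_trans st).
by apply: aeW => t /andP[t0 tT]; apply: hE; rewrite !ltW.
Qed.

(** If the integral is finite, its primitive F is absolutely continuous with
    derivative |g|, and f - F cannot increase.  So no bound on g is needed. *)
Lemma ac_le_integral T f g : 0 <= T -> measurable_fun setT g ->
  ac_deriv T f g ->
  ((f T - f 0)%:E <= \int[mu]_(t in `[0%R, T]) `|g t|%:E)%E.
Proof.
move=> T0 mg Hf.
have [->|goo] := eqVneq (\int[mu]_(t in `[0%R, T]) `|g t|%:E)%E +oo%E.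
  by rewrite leey.
have ig : mu.-integrable `[0, T] (EFin \o (fun t => `|g t|)).
  apply/integrableP; split.
    apply/measurable_EFinP; apply: measurableT_comp => //.
    exact: measurable_funS mg.
  under eq_integral do rewrite /= normr_id.
  by rewrite ltey.
have HF := ac_integral T0 ig.
have gg : {ae mu, forall t, 0 < t < T -> g t - `|g t| <= 0}.
  by apply: aeW => t _; rewrite subr_le0 ler_norm.
have := ac_deriv_ge (ac_derivB Hf HF) gg (lexx 0) T0 (lexx T).
rewrite set_itv1 Rintegral_set1 mul0r subr0 => H.
rewrite -[leRHS]fineK; last exact: (integrable_fin_num _ ig).
rewrite lee_fin -[fine _]/(\int[mu]_(t in `[0, T]) `|g t|); lra.
Qed.

End IntegralOfDerivative.

(** * Gluing at an instant *)

Section Gluing.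
Context {R : realType}.
Implicit Types (S T : R) (f g : R -> R).
Local Notation mu := (@lebesgue_measure R).

(** The last two hypotheses say that phi neither stretches intervals nor makes
    disjoint ones overlap; the retractions of the line onto a half-line do so. *)
Lemma abs_cont_clip (a b a' b' : R) f (phi : R -> R) : abs_cont a b f ->
  (forall t, a' <= t <= b' -> a <= phi t <= b) ->
  (forall l r, l <= r -> phi l <= phi r /\ phi r - phi l <= r - l) ->
  (forall l r x, phi l < x -> x < phi r -> l < x < r) ->
  abs_cont a' b' (f \o phi).
Proof.
move=> Hf phiab phi_nd phi_itv e e0; have [d d0 Hd] := Hf e e0.
exists d => // n l r lr tr lrd.
apply: (Hd n (fun i => phi (l i)) (fun i => phi (r i))).
- move=> i; have [/andP[h1 h2] h3] := lr i.
  have /andP[-> _] := phiab (l i) ltac:(by rewrite h1 (le_trans h2)).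
  have /andP[_ ->] := phiab (r i) ltac:(by rewrite h3 (le_trans h1)).
  by have [-> _] := phi_nd _ _ h2.
- move=> i j _ _ [x [/=]]; rewrite !in_itv/= => /andP[h1 h2] /andP[h3 h4].
  by apply: tr => //; exists x; split; rewrite /= in_itv; exact: phi_itv.
- apply: le_lt_trans lrd; apply: ler_sum => i _.
  by have [/andP[_ h2] _] := lr i; have [] := phi_nd _ _ h2.
Qed.

Definition glue S f g : R -> R := fun t => if t <= S then f t else g t.

Lemma glueE_le S f g t : t <= S -> glue S f g t = f t.
Proof. by rewrite /glue => ->. Qed.

Lemma glueE_ge S f g t : f S = g S -> S <= t -> glue S f g t = g t.
Proof.
move=> fg; rewrite le_eqVlt /glue => /predU1P[<-|]; first by rewrite lexx.
by rewrite leNgt => ->.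
Qed.

(** The glued function is the sum of f stopped at S and g started at S, up to
    the constant g S. *)
Lemma ac_deriv_glue S T f g f' g' : 0 <= S -> S <= T -> f S = g S ->
  ac_deriv S f f' -> ac_deriv T g g' ->
  ac_deriv T (glue S f g) (glue S f' g').
Proof.
move=> S0 ST fg [Hf Hf'] [Hg Hg']; split.
  have Hmin : abs_cont 0 T (f \o Num.min S).
    apply: (abs_cont_clip Hf).
    - by move=> t /andP[t0 _]; rewrite le_min S0 t0 ge_min lexx.
    - move=> l r lr; rewrite /Num.min; case: (ltP S l) => ?; case: (ltP S r) => ?; lra.
    - move=> l r x; rewrite /Num.min; case: (ltP S l) => ?; case: (ltP S r) => ? ? ?; apply/andP; split; lra.
  have Hmax : abs_cont 0 T (g \o Num.max S).
    apply: (abs_cont_clip Hg).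
    - by move=> t /andP[_ tT]; rewrite le_max S0 ge_max ST tT.
    - move=> l r lr; rewrite /Num.max; case: (ltP S l) => ?; case: (ltP S r) => ?; lra.
    - move=> l r x; rewrite /Num.max; case: (ltP S l) => ?; case: (ltP S r) => ? ? ?; apply/andP; split; lra.
  apply: eq_abs_cont (abs_contB (abs_contD Hmin Hmax) (abs_cont_cst _ _ (g S))) => t _ /=.
  case: (leP S t) => St.
    by rewrite glueE_ge// fg addrAC subrr add0r.
  by rewrite glueE_le ?ltW// addrK.
apply: (ae_imply2 (ae_neq S) (ae_imply2 Hf' Hg' (fun t => @conj _ _))) => t tS [ff' gg'] /andP[t0 tT].
have [tltS|] := ltP t S.
  rewrite glueE_le ?ltW//; apply: near_eq_is_derive (ff' _); last by rewrite t0.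
  have H : \forall x \near t, x < S by exact: lt_nbhsl.
  by apply: filterS H => x xS; rewrite glueE_le// ltW.
rewrite le_eqVlt eq_sym (negbTE tS)/= => Slt.
rewrite {2}/glue leNgt Slt/=; apply: near_eq_is_derive (gg' _); last by rewrite t0.
have H : \forall x \near t, S < x by exact: lt_nbhsr.
by apply: filterS H => x xS; rewrite /glue leNgt xS.
Qed.

Lemma measurable_glue S T f g : measurable_fun `[0, S] f ->
  measurable_fun `[0, T] g -> 0 <= S -> S <= T ->
  measurable_fun `[0, T] (glue S f g).
Proof.
move=> mf mg S0 ST.
rewrite (@itv_bndbnd_setU _ _ _ (BRight S)) ?bnd_simp//.
apply/measurable_funU => //; split.
  apply: eq_measurable_fun mf => t; rewrite inE/= in_itv/= => /andP[_ tS].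
  by rewrite glueE_le.
apply: (eq_measurable_fun g).
  by move=> t; rewrite inE/= in_itv/= => /andP[St _]; rewrite /glue leNgt St.
by apply: measurable_funS mg => //; apply: subset_itvr; rewrite bnd_simp.
Qed.

Lemma ac_deriv_cubic S T (c0 c1 c2 c3 : R) : 0 <= S <= T ->
  ac_deriv T
    (fun t => c0 + c1 * (t - S) + c2 * (t - S) ^+ 2 + c3 * (t - S) ^+ 3)
    (fun t => c1 + 2 * c2 * (t - S) + 3 * c3 * (t - S) ^+ 2).
Proof.
move=> /andP[S0 ST]; split.
  apply: (@lipschitz_abs_cont _ _ _ (`|c1| + `|c2| * (2 * T) + `|c3| * (3 * T ^+ 2))).
  move=> s t s0 st tT.
  rewrite (_ : _ - _ = (c1 + c2 * ((t - S) + (s - S)) + c3 *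
     ((t - S) ^+ 2 + (t - S) * (s - S) + (s - S) ^+ 2)) * (t - s)); last by ring.
  rewrite normrM (ger0_norm (_ : 0 <= t - s)); last lra.
  have hT : 0 <= T by lra.
  have hs : `|s - S| <= T by rewrite ler_norml; apply/andP; split; lra.
  have ht : `|t - S| <= T by rewrite ler_norml; apply/andP; split; lra.
  apply: ler_wpM2r; first lra.
  apply: le_trans (ler_normD _ _) _; apply: lerD; [apply: le_trans (ler_normD _ _) _; apply: lerD => //|].
    rewrite normrM ler_wpM2l//; apply: le_trans (ler_normD _ _) _; lra.
  rewrite normrM ler_wpM2l//; apply: le_trans (ler_normD _ _) _.
  have h2 (a b : R) : `|a| <= T -> `|b| <= T -> `|a * b| <= T ^+ 2.
    by move=> ha hb; rewrite normrM expr2; apply: ler_pM.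
  have := ler_normD ((t - S) ^+ 2) ((t - S) * (s - S)).
  have := h2 _ _ ht hs; have := h2 _ _ ht ht; have := h2 _ _ hs hs.
  rewrite -!expr2; lra.
suff H (t : R) : is_derive t 1
    (fun t => c0 + c1 * (t - S) + c2 * (t - S) ^+ 2 + c3 * (t - S) ^+ 3)
    (c1 + 2 * c2 * (t - S) + 3 * c3 * (t - S) ^+ 2).
  by apply: aeW => t _; exact: H.
rewrite (_ : (fun t => _) = ((fun=> c0) + (fun t => c1 * (t - S)) +
  (fun t => c2 * (t - S) ^+ 2) + (fun t => c3 * (t - S) ^+ 3))); last by [].
have dS : is_derive t 1 (fun t => t - S) 1.
  by rewrite -[X in is_derive _ _ _ X]subr0; apply: is_deriveB.
apply: is_derive_eq; rewrite /GRing.scale/=.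
ring.
Qed.

End Gluing.

(** * Trajectories of the double integrator *)

Section Trajectories.
Context {R : realType}.
Implicit Types (S T e : R) (x y u : R -> R).
Local Notation mu := (@lebesgue_measure R).

Lemma fuller_traj_sub S T a b x y u : S <= T -> fuller_traj T a b x y u ->
  fuller_traj S a b x y u.
Proof.
move=> ST [mu_ u1 xy yu x0]; split => //.
- by apply: measurable_funS mu_ => //; apply: subset_itvl; rewrite bnd_simp.
- by move=> t /andP[t0 tS]; apply: u1; rewrite t0 (le_trans tS).
- exact: ac_deriv_sub xy.
- exact: ac_deriv_sub yu.
Qed.

Lemma fuller_traj_convex T a b x y u x' y' u' e : 0 <= e <= 1 ->
  fuller_traj T a b x y u -> fuller_traj T a b x' y' u' ->
  fuller_traj T a b (fun t => (1 - e) * x t + e * x' t)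
    (fun t => (1 - e) * y t + e * y' t) (fun t => (1 - e) * u t + e * u' t).
Proof.
move=> /andP[e0 e1] [mu_ u1 xy yu [x0 y0]] [mu' u1' xy' yu' [x0' y0']]; split => //.
- by apply: measurable_funD; apply: measurable_funM.
- move=> t tT; apply: le_trans (ler_normD _ _) _.
  rewrite !normrM ger0_norm ?subr_ge0// (ger0_norm e0).
  have := u1 t tT; have := u1' t tT => h h'.
  have := ler_wpM2l e0 h; have := ler_wpM2l (_ : 0 <= 1 - e) h'.
  rewrite subr_ge0 => /(_ e1); lra.
- by apply: ac_derivD; apply: ac_derivZ.
- by apply: ac_derivD; apply: ac_derivZ.
- by rewrite x0 y0 x0' y0'; split; ring.
Qed.

Lemma measurable_reflect T u : measurable_fun `[0, T] u ->
  measurable_fun `[0, T] (fun t => u (T - t)).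
Proof.
move=> mu_; apply: (measurable_comp (F := `[0, T]%classic)) mu_ _ => //.
  move=> _ [t /= tT <-]; move: tT; rewrite !in_itv/= => /andP[t0 tT].
  by apply/andP; split; lra.
apply: measurable_funS (_ : measurable_fun setT _) => //.
by apply: continuous_measurable_fun => t; apply: cvgB; [exact: cvg_cst|exact: cvg_id].
Qed.

(** Reversing time changes the sign of the velocity and keeps the control. *)
Lemma fuller_traj_reflect T a b a' b' x y u : 0 <= T ->
  fuller_traj T a b x y u -> x T = a' -> y T = b' ->
  fuller_traj T a' (- b') (fun t => x (T - t)) (fun t => - y (T - t))
    (fun t => u (T - t)).
Proof.
move=> T0 [mu_ u1 xy yu [x0 y0]] xT yT; split.
- exact: measurable_reflect.
- by move=> t /andP[t0 tT]; apply: u1; apply/andP; split; lra.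
- exact: ac_deriv_reflect.
- have := ac_derivN (ac_deriv_reflect yu); apply: eq_ac_deriv => //.
  by apply: aeW => t _; rewrite opprK.
- by rewrite subr0 xT yT.
Qed.

Lemma fuller_traj_glue S T a b x y u x' y' u' : 0 <= S -> S <= T ->
  fuller_traj S a b x y u ->
  measurable_fun `[0, T] u' -> (forall t, S < t -> t <= T -> `|u' t| <= 1) ->
  ac_deriv T x' y' -> ac_deriv T y' u' ->
  x S = x' S -> y S = y' S ->
  fuller_traj T a b (glue S x x') (glue S y y') (glue S u u').
Proof.
move=> S0 ST [mu_ u1 xy yu [x0 y0]] mu' u1' xy' yu' xS yS; split.
- exact: measurable_glue.
- move=> t /andP[t0 tT]; rewrite /glue; case: (leP t S) => tS; last exact: u1'.
  by apply: u1; rewrite t0.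
- exact: ac_deriv_glue.
- exact: ac_deriv_glue.
- by rewrite !glueE_le.
Qed.

(** Any state (A, B) is brought to rest at the origin by the cubic Hermite
    interpolant over a duration tau: its second derivative is affine in t, with
    end values of order |A| / tau^2 + |B| / tau, so it is an admissible control
    once tau is large. *)
Lemma fuller_traj_steer S a b x y u : 0 <= S -> fuller_traj S a b x y u ->
  exists S' x' y' u', [/\ S <= S', fuller_inf_traj a b x' y' u',
    forall t, t <= S -> x' t = x t & forall t, S' <= t -> x' t = 0].
Proof.
move=> S0 Hx; pose A := x S; pose B := y S.
pose tau : R := 6 * `|A| + 4 * `|B| + 1.
have tau1 : 1 <= tau by have := normr_ge0 A; have := normr_ge0 B; rewrite /tau; lra.
have tau0 : 0 < tau by lra.
have tauN0 : tau != 0 by rewrite gt_eqF.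
pose i := tau^-1; have i0 : 0 < i by rewrite invr_gt0.
have itau : i * tau = 1 by rewrite mulVf.
have i1 : i <= 1 by rewrite invf_le1.
(* Coefficients, in powers of t - S, of the cubic with value A and slope B at
   S, and with value and slope zero at S + tau. *)
pose c2 := - 3 * A * i ^+ 2 - 2 * B * i.
pose c3 := 2 * A * i ^+ 3 + B * i ^+ 2.
pose px t := A + B * (t - S) + c2 * (t - S) ^+ 2 + c3 * (t - S) ^+ 3.
pose py t := B + 2 * c2 * (t - S) + 3 * c3 * (t - S) ^+ 2.
pose pu t := 2 * c2 + 6 * c3 * (t - S).
pose S' := S + tau.
have bound (a' b' : R) : `|a'| <= 6 * `|A| -> `|b'| <= 4 * `|B| -> `|a' * i ^+ 2 + b' * i| <= 1.
  move=> ha hb; apply: le_trans (ler_normD _ _) _.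
  rewrite !normrM !(ger0_norm (ltW i0)) -expr2.
  have h1 : `|a'| * i ^+ 2 <= 6 * `|A| * i.
    apply: ler_pM => //; first exact: sqr_ge0.
    by rewrite expr2 ger_pMl.
  have h2 : `|b'| * i <= 4 * `|B| * i by rewrite ler_wpM2r// ltW.
  have : (6 * `|A| + 4 * `|B| + 1) * i = 1.
    by rewrite mulrC -/tau.
  lra.
have pu1 t : S < t -> t <= S' -> `|pu t| <= 1.
  move=> St tS'; pose s := (t - S) * i.
  have s0 : 0 <= s by rewrite mulr_ge0 ?ltW// subr_gt0.
  have s1 : s <= 1 by rewrite /s -itau mulrC ler_wpM2l ?(ltW i0)//; move: tS'; rewrite /S'; lra.
  (* The control interpolates linearly between its two end values. *)
  have -> : pu t = (1 - s) * (- 6 * A * i ^+ 2 + - 4 * B * i) + s * (6 * A * i ^+ 2 + 2 * B * i).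
    by rewrite /pu /c2 /c3 /s; ring.
  clearbody s; apply: le_trans (ler_normD _ _) _.
  rewrite (normrM (1 - s)) (normrM s) (ger0_norm s0) ger0_norm ?subr_ge0//.
  have h1 := bound (- 6 * A) (- 4 * B).
  have h2 := bound (6 * A) (2 * B).
  have {}h1 : `| - 6 * A * i ^+ 2 + - 4 * B * i | <= 1.
    by apply: h1; rewrite normrM ler_wpM2r// ler_norml; apply/andP; split; lra.
  have {}h2 : `| 6 * A * i ^+ 2 + 2 * B * i | <= 1.
    by apply: h2; rewrite normrM ler_wpM2r// ler_norml; apply/andP; split; lra.
  have := ler_wpM2l s0 h2; have := ler_wpM2l (_ : 0 <= 1 - s) h1.
  rewrite subr_ge0 => /(_ s1); lra.
have SS' : S <= S' by rewrite /S' lerDl ltW.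
have S'0 : 0 <= S' by exact: le_trans SS'.
have pxy T : S <= T -> ac_deriv T px py by move=> ST; apply: ac_deriv_cubic; rewrite S0.
have pyu T : S <= T -> ac_deriv T py pu.
  move=> ST; have : 0 <= S <= T by rewrite S0.
  move=> /(ac_deriv_cubic B (2 * c2) (3 * c3) 0); apply: eq_ac_deriv.
    by move=> t _; rewrite /py; ring.
  by apply: aeW => t _; rewrite /pu mulr0 mul0r addr0 mulrA -natrM.
have mpu : measurable_fun `[0, S'] pu.
  apply: measurable_funS (_ : measurable_fun setT _) => //.
  apply: continuous_measurable_fun => t; apply: cvgD; first exact: cvg_cst.
  by apply: cvgM; [exact: cvg_cst|apply: cvgB; [exact: cvg_id|exact: cvg_cst]].
have Hx' : fuller_traj S' a b (glue S x px) (glue S y py) (glue S u pu).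
  apply: fuller_traj_glue => //; [exact: pxy|exact: pyu| |].
    by rewrite /px subrr -/A; ring.
  by rewrite /py subrr -/B; ring.
have tS : S' - S = tau by rewrite /S' addrAC subrr add0r.
have xS' : glue S x px S' = 0.
  rewrite glueE_ge//; last by rewrite /px subrr -/A; ring.
  rewrite /px tS /c2 /c3.
  transitivity (A * (1 - 3 * (i * tau) ^+ 2 + 2 * (i * tau) ^+ 3) + B * tau * (1 - 2 * (i * tau) + (i * tau) ^+ 2)).
    by ring.
  by rewrite itau; ring.
have yS' : glue S y py S' = 0.
  rewrite glueE_ge//; last by rewrite /py subrr -/B; ring.
  rewrite /py tS /c2 /c3.
  transitivity (A * i * (- 6 * (i * tau) + 6 * (i * tau) ^+ 2) + B * (1 - 4 * (i * tau) + 3 * (i * tau) ^+ 2)).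
    by ring.
  by rewrite itau; ring.
exists S', (glue S' (glue S x px) (fun=> 0)), (glue S' (glue S y py) (fun=> 0)),
  (glue S' (glue S u pu) (fun=> 0)); split => //.
(* Gluing needs a horizon beyond S', hence the maximum. *)
- move=> T T0; apply: (@fuller_traj_sub _ (Num.max S' T)); first by rewrite le_max lexx orbT.
  apply: fuller_traj_glue => //; rewrite ?le_max ?lexx//; [|exact: ac_deriv_cst|exact: ac_deriv_cst].
  by move=> *; rewrite normr0.
- by move=> t tS_; rewrite !glueE_le// (le_trans tS_).
- by move=> t S't; rewrite glueE_ge.
Qed.

End Trajectories.

(** * Integrals of continuous functions and first-order optimality *)

Section ContinuousIntegrals.
Context {R : realType}.
Implicit Types (S T : R) (f g : R -> R).
Local Notation mu := (@lebesgue_measure R).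

Lemma continuous_itv_integrable T f : {within `[0, T], continuous f} ->
  mu.-integrable `[0, T] (EFin \o f).
Proof. by move=> cf; apply: continuous_compact_integrable => //; exact: segment_compact. Qed.

Lemma integrable_itvZ T f (c : R) : mu.-integrable `[0, T] (EFin \o f) ->
  mu.-integrable `[0, T] (EFin \o (fun t => c * f t)).
Proof. by move=> if_; exact: (integrableZl _ c if_). Qed.

Lemma within_continuousM T f g : {within `[0, T], continuous f} ->
  {within `[0, T], continuous g} ->
  {within `[0, T], continuous (fun t => f t * g t)}.
Proof. by move=> cf cg t; apply: continuousM; [exact: cf|exact: cg]. Qed.

(** Both sides are end values of absolutely continuous functions that vanish at
    0 and have the same derivative. *)
Lemma Rintegral_reflect T f : 0 <= T -> mu.-integrable `[0, T] (EFin \o f) ->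
  mu.-integrable `[0, T] (EFin \o (fun t => f (T - t))) ->
  \int[mu]_(t in `[0, T]) f (T - t) = \int[mu]_(t in `[0, T]) f t.
Proof.
move=> T0 if1 if2.
have HF := ac_integral T0 if1; have HG := ac_integral T0 if2.
pose F t := \int[mu]_(s in `[0, t]) f s.
have HF' : ac_deriv T (fun t => F T - F (T - t)) (fun t => f (T - t)).
  apply: eq_ac_deriv (ac_derivB (ac_deriv_cst T (F T)) (ac_deriv_reflect HF)) => //.
  by apply: aeW => t _; rewrite sub0r opprK.
have T0T : 0 <= T <= T by rewrite T0 lexx.
have F0 : F 0 = 0 by rewrite /F set_itv1 Rintegral_set1.
rewrite (ac_deriv_unique HG HF' _ T0T); first by rewrite subrr F0 subr0.
by rewrite set_itv1 Rintegral_set1 subr0 subrr.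
Qed.

Lemma ae_dense T (P : R -> Prop) :
  {ae mu, forall t, 0 < t < T -> P t} ->
  forall t e, 0 < t < T -> 0 < e ->
  exists s, [/\ 0 < s < T, `|s - t| < e & P s].
Proof.
move=> /ae_null_set[N [mN N0 HN]] t e /andP[t0 tT] e0.
pose d := Num.min e (Num.min t (T - t)).
have [d0 de dt dT] : [/\ 0 < d, d <= e, d <= t & d <= T - t].
  rewrite /d !lt_min !ge_min !lexx !orbT e0 t0; split => //=; lra.
apply: contrapT => H.
have sub : `]t, t + d[%classic `<=` N.
  move=> s /=; rewrite in_itv/= => /andP[ts std]; apply: contrapT => Ns.
  have sT : 0 < s < T by apply/andP; split; lra.
  apply: H; exists s; split => //; last exact: HN.
  rewrite ger0_norm; lra.
have Z := @subset_measure0 _ _ _ (@lebesgue_measure R) `]t, t + d[%classic N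
  (measurable_itv _) mN sub N0.
have E : lebesgue_measure `]t, t + d[%classic = d%:E.
  by rewrite lebesgue_measure_itv/= lte_fin ltrDl d0 -EFinB addrAC subrr add0r.
have : d%:E = 0%E by rewrite -E; exact: Z.
by move=> [] d00; rewrite d00 ltxx in d0.
Qed.

Lemma abs_cont_eq0 T f : abs_cont 0 T f ->
  {ae mu, forall t, 0 < t < T -> f t = 0} ->
  forall t, 0 < t < T -> f t = 0.
Proof.
move=> Hf f0 t tT; apply/eqP; rewrite -normr_le0; apply/ler_addgt0Pr => e e0.
have [d d0 Hd] := abs_cont_modulus Hf e0.
have [s [sT std fs]] := ae_dense f0 tT d0.
have := Hd t s; rewrite fs sub0r normrN add0r => H; apply/ltW/H => //.
- by case/andP: tT => *; rewrite !ltW.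
- by case/andP: sT => *; rewrite !ltW.
Qed.

(** The primitive of f^2 is nondecreasing and ends at a nonpositive value, so it
    vanishes, and so does its derivative. *)
Lemma Rintegral_sqr_eq0 T f : abs_cont 0 T f ->
  \int[mu]_(t in `[0, T]) (f t * f t) <= 0 ->
  forall t, 0 < t < T -> f t = 0.
Proof.
move=> Hf I0 t tT; have T0 : 0 <= T by case/andP: tT => ? ?; lra.
have cf := abs_cont_continuous Hf.
have HF := ac_integral T0 (continuous_itv_integrable (within_continuousM cf cf)).
set F := fun t => _ in HF.
have F0 s : 0 <= s <= T -> F s = 0.
  move=> /andP[s0 sT].
  have h1 : 0 <= F s by apply: Rintegral_ge0 => r _; rewrite -expr2 sqr_ge0.
  have h2 : - F T - - F s <= 0 * (T - s).
    apply: (ac_deriv_ge (ac_derivN HF)) => //.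
    by apply: aeW => r _; rewrite oppr_le0 -expr2 sqr_ge0.
  have : F T <= 0 by exact: I0.
  lra.
have f0 : {ae mu, forall s, 0 < s < T -> f s = 0}.
  have H0 := eq_ac_deriv (f' := fun=> 0) F0 (g' := fun s => f s * f s) _ HF.
  have [|_ {}H0] := H0; first by apply: aeW.
  apply: (ae_imply H0) => s H /H [_ Hs].
  have : f s * f s = 0 by rewrite -Hs derive_cst.
  by move/eqP; rewrite mulf_eq0 orbb => /eqP.
exact: (abs_cont_eq0 Hf f0).
Qed.

End ContinuousIntegrals.

Section FirstOrder.
Context {R : realType}.
Implicit Types (S T : R) (f g : R -> R).
Local Notation mu := (@lebesgue_measure R).

Lemma fuller_traj_abs_cont T a b x y u : fuller_traj T a b x y u ->
  abs_cont 0 T x.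
Proof. by move=> [_ _ [? _] _ _]. Qed.

Lemma fuller_cost_finite T x : {within `[0, T], continuous x} ->
  fuller_cost `[0, T] x = (2^-1 * \int[mu]_(t in `[0, T]) (x t * x t))%:E.
Proof.
move=> cx; rewrite /fuller_cost EFinM; congr (_ * _)%E.
rewrite /Rintegral fineK//.
exact/integrable_fin_num/continuous_itv_integrable/within_continuousM.
Qed.

Lemma fuller_cost_support T x : (forall t, T <= t -> x t = 0) ->
  fuller_cost `[0%R, +oo[ x = fuller_cost `[0, T] x.
Proof.
move=> x0; rewrite /fuller_cost; congr (_ * _)%E.
rewrite integral_mkcond [RHS]integral_mkcond; apply: eq_integral => t _.
rewrite !patchE !mem_setE !in_itv/= andbT.
case: (leP 0 t) => //= t0; case: (leP t T) => //= Tt.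
by rewrite x0 ?ltW// expr0n.
Qed.

Lemma Rintegral_support S T f : S <= T -> (forall t, S <= t -> f t = 0) ->
  \int[mu]_(t in `[0, T]) f t = \int[mu]_(t in `[0, S]) f t.
Proof.
move=> ST f0; rewrite Rintegral_mkcond [RHS]Rintegral_mkcond.
apply: eq_Rintegral => t _; rewrite !patchE !mem_setE !in_itv/=.
case: (leP 0 t) => //= t0; case: (leP t S) => [tS|/ltW/f0 ->].
  by rewrite (le_trans tS).
by case: ifP.
Qed.

(** The variational inequality of the convex infinite-horizon problem, tested
    with x extended beyond S by a trajectory that reaches the origin: this keeps
    the cost of the competitors finite, and the extension does not show in the
    integral because the optimal xh is zero there. *)
Lemma fuller_inf_first_order S a b xh yh uh x y u : 0 <= S ->
  fuller_inf_optimal a b xh yh uh -> (forall t, S <= t -> xh t = 0) ->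
  fuller_traj S a b x y u ->
  0 <= \int[mu]_(t in `[0, S]) (xh t * (x t - xh t)).
Proof.
move=> S0 [Hxh opt] xh0 Hx.
have [T [X [Y [U [ST HX Xx X0]]]]] := fuller_traj_steer S0 Hx.
have T0 : 0 <= T by exact: le_trans ST.
have xhT t : T <= t -> xh t = 0 by move=> Tt; apply: xh0; exact: le_trans Tt.
pose d t := X t - xh t.
have axh := fuller_traj_abs_cont (Hxh T T0); have aX := fuller_traj_abs_cont (HX T T0).
have cxh := abs_cont_continuous axh.
have cd : {within `[0, T], continuous d}.
  exact: (abs_cont_continuous (abs_contB aX axh)).
pose A := \int[mu]_(t in `[0, T]) (xh t * d t).
pose B := \int[mu]_(t in `[0, T]) (d t * d t).
have AE : \int[mu]_(t in `[0, S]) (xh t * (x t - xh t)) = A.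
  rewrite /A (@Rintegral_support S T (fun t => xh t * d t))//; last by move=> t St; rewrite xh0// mul0r.
  apply: eq_Rintegral => t; rewrite inE/= in_itv/= => /andP[_ tS].
  by rewrite /d Xx.
rewrite AE.
have key e : 0 <= e <= 1 -> 0 <= e * (2 * A) + e ^+ 2 * B.
  move=> e01; pose xe t := xh t + e * d t.
  have xeE : xe = (fun t => (1 - e) * xh t + e * X t).
    by apply/funext => t; rewrite /xe /d; ring.
  have Hxe : fuller_inf_traj a b xe (fun t => (1 - e) * yh t + e * Y t)
      (fun t => (1 - e) * uh t + e * U t).
    by rewrite xeE => r r0; apply: fuller_traj_convex => //; [exact: Hxh|exact: HX].
  have := opt _ _ _ Hxe.
  rewrite (fuller_cost_support xhT) (@fuller_cost_support T xe); last first.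
    by move=> t Tt; rewrite /xe /d xhT// X0// subrr mulr0 addr0.
  have cxe := abs_cont_continuous (fuller_traj_abs_cont (Hxe T T0)).
  rewrite !fuller_cost_finite// lee_fin ler_pM2l ?invr_gt0//.
  have -> : \int[mu]_(t in `[0, T]) (xe t * xe t) =
      \int[mu]_(t in `[0, T]) (xh t * xh t) + e * (2 * A) + e ^+ 2 * B.
    transitivity (\int[mu]_(t in `[0, T]) (xh t * xh t + (e * 2) * (xh t * d t) + (e ^+ 2) * (d t * d t))).
      by apply: eq_Rintegral => t _; rewrite /xe; ring.
    have i1 := continuous_itv_integrable (within_continuousM cxh cxh).
    have i2 := continuous_itv_integrable (within_continuousM cxh cd).
    have i3 := continuous_itv_integrable (within_continuousM cd cd).
    rewrite RintegralD//=; last 2 first.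
    - apply: (integrableD _ i1 (integrable_itvZ (e * 2) i2)) => //.
    - exact: integrable_itvZ.
    rewrite RintegralD//; last exact: integrable_itvZ.
    by rewrite !RintegralZl// -/A -/B mulrA.
  by rewrite -addrA lerDl.
rewrite leNgt; apply/negP => A0.
have B0 : 0 <= B by apply: Rintegral_ge0 => t _; rewrite -expr2 sqr_ge0.
(* If A were negative, this step would make 2 A + e B negative. *)
pose e := Num.min 1 (- A / (B + 1)).
have AB : 0 < - A / (B + 1) by rewrite divr_gt0//; lra.
have e0 : 0 < e by rewrite lt_min ltr01.
have e1 : e <= 1 by rewrite ge_min lexx.
have eB : e * (B + 1) <= - A.
  by rewrite -ler_pdivlMr ?ge_min ?lexx ?orbT//; lra.
have := key e; rewrite (ltW e0) e1 => /(_ isT).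
rewrite expr2 -mulrA -mulrDr pmulr_rge0//; lra.
Qed.

End FirstOrder.

(** * The problem on a finite horizon *)

Section FiniteProblem.
Context {R : realType}.
Implicit Types (S T : R) (x y u : R -> R).
Local Notation mu := (@lebesgue_measure R).

Lemma J_F_optimal a b x y u : fuller_inf_optimal a b x y u ->
  J_F a b = fuller_cost `[0%R, +oo[ x.
Proof.
move=> [Hx opt]; apply/eqP; rewrite eq_le; apply/andP; split.
  by apply: ereal_inf_lbound; exists x, y, u.
by apply: le_ereal_inf_tmp => _ [x' [y' [u' [Hx' ->]]]]; exact: opt Hx'.
Qed.

Variables (T TF0 TF1 x0 y0 x1 y1 : R) (xa ya ua xb yb ub : R -> R).
Hypotheses (TF0_ge0 : 0 <= TF0) (TF1_ge0 : 0 <= TF1) (TFT : TF0 + TF1 <= T).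
Hypotheses (opta : fuller_inf_optimal x0 y0 xa ya ua)
  (za : forall t, TF0 <= t -> [/\ xa t = 0, ya t = 0 & ua t = 0]).
Hypotheses (optb : fuller_inf_optimal x1 (- y1) xb yb ub)
  (zb : forall t, TF1 <= t -> [/\ xb t = 0, yb t = 0 & ub t = 0]).

Let X t := xa t + xb (T - t).
Let T0 : 0 <= T. Proof. exact: le_trans (addr_ge0 TF0_ge0 TF1_ge0) TFT. Qed.
Let TF0T : TF0 <= T. Proof. by apply: le_trans TFT; rewrite lerDl. Qed.
Let TF1T : TF1 <= T. Proof. by apply: le_trans TFT; rewrite lerDr. Qed.

Let late t : t < TF0 -> TF1 <= T - t.
Proof. by move=> t0; rewrite lerBrDr (le_trans _ TFT)// addrC lerD2r ltW. Qed.

Let disjoint_supports t : xa t * xb (T - t) = 0.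
Proof.
have [/za[-> _ _]|t0] := leP TF0 t; first by rewrite mul0r.
have /zb[-> _ _] := late t0.
by rewrite mulr0.
Qed.

(** The controls add up to an admissible one because one of them is always
    zero. *)
Lemma concatenation_feasible :
  fuller_feasible T x0 y0 x1 y1 X (fun t => ya t - yb (T - t))
    (fun t => ua t + ub (T - t)).
Proof.
have [xaT yaT uaT] := za TF0T; have [xbT ybT ubT] := zb TF1T.
have [mua ua1 xya yua [xa0 ya0]] := opta.1 T T0.
have Hb := optb.1 T T0; have [_ _ _ _ [xb0 yb0]] := Hb.
have [mub ub1 xyb yub _] := fuller_traj_reflect T0 Hb xbT ybT.
split; last first.
  by rewrite /X subrr xaT yaT xb0 yb0 add0r sub0r opprK.
split.
- exact: measurable_funD.
- move=> t tT; have [/za[_ _ ->]|t0] := leP TF0 t; first by rewrite add0r; exact: ub1.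
  have /zb[_ _ ->] := late t0.
  by rewrite addr0; exact: ua1.
- exact: ac_derivD.
- exact: ac_derivD.
- by rewrite /X subr0 xbT ybT xa0 ya0 addr0 subr0.
Qed.

Let aX : abs_cont 0 T X.
Proof. by have [/fuller_traj_abs_cont] := concatenation_feasible. Qed.

Lemma concatenation_cost :
  (fuller_cost `[0%R, T] X = J_F x0 y0 + J_F x1 (- y1))%E.
Proof.
have cX := abs_cont_continuous aX.
have aa := fuller_traj_abs_cont (opta.1 T T0); have ca := abs_cont_continuous aa.
have ab := fuller_traj_abs_cont (optb.1 T T0); have cb := abs_cont_continuous ab.
have cb' := abs_cont_continuous (abs_cont_reflect ab).
rewrite (J_F_optimal opta) (J_F_optimal optb).
rewrite (@fuller_cost_support _ T xa); last by move=> t Tt; have [] := za (le_trans TF0T Tt).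
rewrite (@fuller_cost_support _ T xb); last by move=> t Tt; have [] := zb (le_trans TF1T Tt).
rewrite !fuller_cost_finite// -EFinD -mulrDr; congr (_ * _)%:E.
have i1 := continuous_itv_integrable (within_continuousM ca ca).
have i2 := continuous_itv_integrable (within_continuousM cb' cb').
have i3 := continuous_itv_integrable (within_continuousM cb cb).
rewrite -(@Rintegral_reflect _ T (fun t => xb t * xb t))// -RintegralD//.
apply: eq_Rintegral => t _; rewrite /X.
transitivity (xa t * xa t + 2 * (xa t * xb (T - t)) + xb (T - t) * xb (T - t)).
  by ring.
by rewrite disjoint_supports mulr0 addr0.
Qed.

(** Expanding the square leaves twice the integral of X (x - X), which splits
    into the first-order terms of the two halves since their supports are
    disjoint.  The second half is seen from the other end of the time interval. *)
Lemma concatenation_gap x y u : fuller_feasible T x0 y0 x1 y1 x y u ->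
  \int[mu]_(t in `[0, T]) (X t * X t) +
    \int[mu]_(t in `[0, T]) ((x t - X t) * (x t - X t)) <=
  \int[mu]_(t in `[0, T]) (x t * x t).
Proof.
move=> [Hx [xT yT]].
have cX := abs_cont_continuous aX.
have ax := fuller_traj_abs_cont Hx.
have aa := fuller_traj_abs_cont (opta.1 T T0); have ca := abs_cont_continuous aa.
have ab := fuller_traj_abs_cont (optb.1 T T0); have cb := abs_cont_continuous ab.
have cb' := abs_cont_continuous (abs_cont_reflect ab).
have cB f g : abs_cont 0 T f -> abs_cont 0 T g ->
    {within `[0, T], continuous (fun t => f t - g t)}.
  by move=> af ag; exact: abs_cont_continuous (abs_contB af ag).
have cd := cB _ _ ax aX.
have vanish_a t : T <= t -> xa t = 0 by move=> Tt; have [] := za (le_trans TF0T Tt).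
have vanish_b t : T <= t -> xb t = 0 by move=> Tt; have [] := zb (le_trans TF1T Tt).
have h1 := fuller_inf_first_order T0 opta vanish_a Hx.
have h2 := fuller_inf_first_order T0 optb vanish_b (fuller_traj_reflect T0 Hx xT yT).
have ax' := abs_cont_reflect ax.
have ib := continuous_itv_integrable (within_continuousM cb (cB _ _ ax' ab)).
have ib' : mu.-integrable `[0, T] (EFin \o (fun t => xb (T - t) * (x (T - (T - t)) - xb (T - t)))).
  rewrite (_ : (fun t => _) = (fun t => xb (T - t) * (x t - xb (T - t)))); last first.
    by apply/funext => t; rewrite opprB addrCA subrr addr0.
  apply: continuous_itv_integrable; apply: within_continuousM => //.
  exact: cB (abs_cont_reflect ab).
rewrite -(Rintegral_reflect T0 ib ib') in h2.
have ia := continuous_itv_integrable (within_continuousM ca (cB _ _ ax aa)).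
have iXX := continuous_itv_integrable (within_continuousM cX cX).
have idd := continuous_itv_integrable (within_continuousM cd cd).
pose F1 t := xa t * (x t - xa t).
pose F2 t := xb (T - t) * (x (T - (T - t)) - xb (T - t)).
have -> : \int[mu]_(t in `[0, T]) (x t * x t) =
    \int[mu]_(t in `[0, T]) (X t * X t + (x t - X t) * (x t - X t) + 2 * (F1 t + F2 t)).
  apply: eq_Rintegral => t _.
  rewrite /F1 /F2 /X opprB (addrCA T) subrr addr0.
  (* The two sides differ by a multiple of the product of xa and xb, which is
     zero. *)
  have := disjoint_supports t; set p := xa t; set q := xb (T - t) => pq.
  rewrite -[LHS]addr0 -[X in _ + X](mulr0 4) -pq; ring.
rewrite RintegralD//; last 2 first.
- exact: (integrableD _ iXX idd).
- by apply: integrable_itvZ; exact: (integrableD _ ia ib').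
rewrite RintegralD// RintegralZl//; last exact: (integrableD _ ia ib').
rewrite RintegralD// lerDl mulr_ge0// addr_ge0//.
Qed.

Lemma fuller_feasible_minimal x y u : fuller_feasible T x0 y0 x1 y1 x y u ->
  (fuller_cost `[0%R, T] x <= J_F x0 y0 + J_F x1 (- y1))%E ->
  forall t, 0 <= t <= T -> x t = X t.
Proof.
move=> Hx; rewrite -concatenation_cost.
have gap := concatenation_gap Hx.
have [/fuller_traj_abs_cont ax [xT yT]] := Hx.
have [[_ _ _ _ [x00 _]] _] := Hx.
have [[_ _ _ _ [X00 _]] [XT _]] := concatenation_feasible.
rewrite !fuller_cost_finite//; [|exact: abs_cont_continuous|exact: abs_cont_continuous].
rewrite lee_fin ler_pM2l ?invr_gt0// => cost t.
have H : \int[mu]_(t in `[0, T]) ((x t - X t) * (x t - X t)) <= 0 by lra.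
have := Rintegral_sqr_eq0 (abs_contB ax aX) H.
move=> Hin /andP[]; rewrite le_eqVlt => /predU1P[<- _|t0]; first by rewrite x00 X00.
rewrite le_eqVlt => /predU1P[->|tT]; first by rewrite xT XT.
by apply/eqP; rewrite -subr_eq0 Hin// t0.
Qed.

End FiniteProblem.

(** * Unit ball, norm and length of the sub-Finsler structure *)

Section SubFinslerBall.
Context {R : realType}.
Local Notation mu := (@lebesgue_measure R).
Implicit Types (q xi b : 'rV[R]_4).

Lemma ord4_ind (P : 'I_4 -> Prop) : P 0 -> P 1 -> P 2 -> P 3 -> forall j, P j.
Proof.
move=> P0 P1 P2 P3 [[|[|[|[|//]]]] Hj].
- by rewrite (_ : Ordinal Hj = 0)//; exact: val_inj.
- by rewrite (_ : Ordinal Hj = 1)//; exact: val_inj.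
- by rewrite (_ : Ordinal Hj = 2)//; exact: val_inj.
- by rewrite (_ : Ordinal Hj = 3)//; exact: val_inj.
Qed.

Lemma ptE (x y z w : R) : (pt x y z w 0 0 = x) * (pt x y z w 0 1 = y) *
  (pt x y z w 0 2 = z) * (pt x y z w 0 3 = w).
Proof. by rewrite !mxE. Qed.

Lemma pt_eq q (x y z w : R) :
  q 0 0 = x -> q 0 1 = y -> q 0 2 = z -> q 0 3 = w -> q = pt x y z w.
Proof.
move=> q0 q1 q2 q3; apply/rowP; apply: ord4_ind; by rewrite ptE.
Qed.

Definition horizontal q (u v : R) : 'rV[R]_4 := v *: f1 q + u *: f2 q.

Lemma horizontalE q (u v : R) :
  (horizontal q u v 0 0 = v * q 0 1) * (horizontal q u v 0 1 = u) *
  (horizontal q u v 0 2 = v * (2^-1 * q 0 0 ^+ 2)) *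
  (horizontal q u v 0 3 = v).
Proof.
have hE j : horizontal q u v 0 j = v * f1 q 0 j + u * f2 q 0 j by rewrite !mxE.
by rewrite !hE /f1 /f2 !ptE !mulr0 !mulr1 !addr0 add0r.
Qed.

(** With weights (1 + s v) (1 + s' u) / 4, for signs s and s', the convex
    combination of the four vertices has coordinates v and u in f1 and f2. *)
Lemma sf_ballP q b : sf_ball q b <->
  exists u v : R, [/\ `|u| <= 1, `|v| <= 1 & b = horizontal q u v].
Proof.
split.
  move=> [c [c0 c1 ->]].
  exists (\sum_s c s * (-1) ^+ s.2), (\sum_s c s * (-1) ^+ s.1).
  have bnd (h : bool * bool -> bool) : `|\sum_s c s * (-1) ^+ h s| <= 1.
    rewrite -[leRHS]c1; apply: le_trans (ler_norm_sum _ _ _) _; apply: ler_sum => s _.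
    by rewrite normrM normr_sign mulr1 ger0_norm.
  split; [exact: bnd|exact: bnd|].
  rewrite /horizontal !scaler_suml -big_split/=; apply: eq_bigr => s _.
  by rewrite scalerDr !scalerA.
move=> [u [v [u1 v1 ->]]].
exists (fun s : bool * bool => 4^-1 * (1 + (-1) ^+ s.1 * v) * (1 + (-1) ^+ s.2 * u)).
have pos (s : bool) (r : R) : `|r| <= 1 -> 0 <= 1 + (-1) ^+ s * r.
  by rewrite ler_norml => /andP[? ?]; case: s; rewrite ?expr1 ?expr0; lra.
split.
- by move=> s; rewrite !mulr_ge0 ?pos// invr_ge0.
- rewrite -(pair_bigA _ (fun i j : bool => 4^-1 * (1 + (-1) ^+ i * v) * (1 + (-1) ^+ j * u)))/=.
  by rewrite !big_bool/= !expr1 !expr0; field.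
- pose G (i j : bool) := (4^-1 * (1 + (-1) ^+ i * v) * (1 + (-1) ^+ j * u)) *:
    ((-1) ^+ i *: f1 q + (-1) ^+ j *: f2 q).
  transitivity (\sum_(p : bool * bool) G p.1 p.2); last by apply: eq_bigr.
  rewrite -(pair_bigA _ G) /G !big_bool/= !expr1 !expr0.
  rewrite /horizontal; apply/rowP => j; by rewrite !mxE; field.
Qed.

Lemma sf_norm_ge0 q xi : (0 <= sf_norm q xi)%E.
Proof. by apply: le_ereal_inf_tmp => _ [a [a0 _] <-]; rewrite lee_fin. Qed.

Lemma sf_norm_ge_w q xi : (`|xi 0 3|%:E <= sf_norm q xi)%E.
Proof.
apply: le_ereal_inf_tmp => _ [a [a0 [b /sf_ballP[u [v [u1 v1 ->]]] ->]] <-].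
by rewrite lee_fin mxE horizontalE normrM ger0_norm// ler_piMr.
Qed.

Lemma sf_norm_horizontal q (u v : R) : `|u| <= 1 -> `|v| <= 1 ->
  (sf_norm q (horizontal q u v) <= 1%:E)%E.
Proof.
move=> u1 v1; apply: ereal_inf_lbound; exists 1 => //; split => //.
by exists (horizontal q u v); [apply/sf_ballP; exists u, v|rewrite scale1r].
Qed.

(** The norm is an infimum, so a priori the vector is only in every larger
    multiple of the ball.  Its coordinates on the independent f1 and f2 can be
    read off as those along y and w, and pass to the limit. *)
Lemma sf_norm_le1 q xi : (sf_norm q xi <= 1%:E)%E ->
  [/\ `|xi 0 1| <= 1, `|xi 0 3| <= 1 & xi = horizontal q (xi 0 1) (xi 0 3)].
Proof.
move=> H.
have near1 e : 0 < e -> exists a u v : R, [/\ 0 <= a < 1 + e, `|u| <= 1, `|v| <= 1 &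
    xi = a *: horizontal q u v].
  move=> e0; have : (sf_norm q xi < (1 + e)%:E)%E.
    by apply: le_lt_trans H _; rewrite lte_fin ltrDl.
  move=> /ereal_inf_lt[_ [a [a0 [b /sf_ballP[u [v [u1 v1 ->]]] xiE]] <-]].
  by rewrite lte_fin => ae; exists a, u, v; rewrite a0.
have scaled (a u : R) e : 0 <= a < 1 + e -> `|u| <= 1 -> `|a * u| <= 1 + e.
  move=> /andP[a0 ae] u1; rewrite normrM ger0_norm//.
  by apply: le_trans (ltW ae); rewrite ler_piMr.
split.
- apply/ler_addgt0Pr => e /near1[a [u [v [ae u1 _ ->]]]].
  by rewrite mxE horizontalE; exact: scaled.
- apply/ler_addgt0Pr => e /near1[a [u [v [ae _ v1 ->]]]].
  by rewrite mxE horizontalE; exact: scaled.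
- have [a [u [v [_ _ _ ->]]]] := near1 _ ltr01.
  have Z j : (a *: horizontal q u v) 0 j = a * horizontal q u v 0 j by rewrite mxE.
  by apply/rowP; apply: ord4_ind; rewrite !horizontalE !Z !horizontalE ?mulrA.
Qed.

End SubFinslerBall.

Section SubFinslerLength.
Context {R : realType}.
Local Notation mu := (@lebesgue_measure R).
Implicit Types (T : R) (c : R -> 'rV[R]_4).

(** Integrals of nonnegative functions are suprema over simple minorants, so
    they are monotone without measurability.  This matters for the norm of the
    velocity of a curve, which is meaningless on a null set. *)
Lemma ge0_le_integral_nonmeasurable (D : set R) (f g : R -> \bar R) :
  (forall t, D t -> (0 <= f t)%E) -> (forall t, D t -> (f t <= g t)%E) ->
  (\int[mu]_(t in D) f t <= \int[mu]_(t in D) g t)%E.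
Proof.
move=> f0 fg; rewrite !ge0_integralE//; last by move=> t Dt; exact: le_trans (f0 t Dt) (fg t Dt).
apply: le_ereal_sup => _ [h /= hf <-]; exists h => //= t.
apply: le_trans (hf t) _; rewrite !patchE; case: ifPn => //.
by rewrite inE; exact: fg.
Qed.

(** Comparison with a measurable function that is infinite on the exceptional
    null set. *)
Lemma integral_le_itv_length T (f : R -> \bar R) : 0 <= T ->
  (forall t, (0 <= f t)%E) -> {ae mu, forall t, 0 < t < T -> (f t <= 1%:E)%E} ->
  (\int[mu]_(t in `[0%R, T]) f t <= T%:E)%E.
Proof.
move=> T0 f0 /ae_closed_itv/ae_null_set[N [mN N0 HN]].
pose g : R -> \bar R := fun t => if t \in N then +oo%E else 1%:E.
have mg : measurable_fun setT g.
  apply: measurable_fun_if => //; apply: (measurable_fun_bool true).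
  rewrite setTI (_ : _ @^-1` _ = N)//; apply/seteqP.
  by split => t /=; [move=> /set_mem|move=> /mem_set ->].
apply: le_trans (_ : (\int[mu]_(t in `[0%R, T]) g t <= _)%E).
  apply: ge0_le_integral_nonmeasurable => // t; rewrite /= in_itv/= => tT.
  rewrite /g; case: ifPn => [_|]; first by rewrite leey.
  by rewrite notin_setE => Nt; exact: HN.
rewrite (ae_eq_integral (cst 1%:E)) => //=.
- by rewrite integral_cst//= mul1e lebesgue_measure_itv/= lte_fin; case: ltP => // _;
    rewrite ?oppr0 ?adde0 ?lee_fin.
- exact: measurable_funS mg.
- exists N; split => // t /= H; apply: contrapT => Nt; apply: H => _.
  by rewrite /g memNset.
Qed.

Lemma ac_deriv_derive1 T f g : ac_deriv T f g -> ac_deriv T f (fun t => derive1 f t : R).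
Proof.
move=> [Hf Hg]; split => //; apply: (ae_imply Hg) => t H tT.
by rewrite derive1E; have [df _] := H tT; exact: DeriveDef.
Qed.

(** The w component alone accounts for the length, whatever the duration of the
    curve and however large its velocity. *)
Lemma sf_length_ge q0 q1 T c : ac_curve q0 q1 T c ->
  ((q1 0 3 - q0 0 3)%:E <= sf_length T c)%E.
Proof.
move=> [T0 Hc [<- <-]].
have [Hw Hw'] := Hc 3.
have dw : {ae mu, forall t, 0 < t < T -> derivable (fun t => c t 0 3) t 1}.
  by apply: (ae_imply Hw') => t H /H[].
have [g [mg gE g0]] := abs_cont_measurable_derivative T0 Hw dw.
apply: le_trans (ac_le_integral T0 mg (conj Hw gE)) _.
apply: ge0_le_integral_nonmeasurable => t _; first by rewrite lee_fin.
have [->|[_ Hg]] := g0 t; first by rewrite normr0 sf_norm_ge0.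
apply: le_trans (sf_norm_ge_w _ _); rewrite lee_fin mxE derive1E.
by have [_ ->] := Hg.
Qed.

End SubFinslerLength.

(** * Rigidity of curves of minimal duration *)

Section Rigidity.
Context {R : realType}.
Local Notation mu := (@lebesgue_measure R).
Implicit Types (T : R) (f g : R -> R).

Lemma ac_deriv_ae_unique T f g f' g' : ac_deriv T f g -> ac_deriv T f' g' ->
  (forall t, 0 <= t <= T -> f t = f' t) ->
  {ae mu, forall t, 0 < t < T -> g t = g' t}.
Proof.
move=> Hf Hf' ff'.
have gg : {ae mu, forall t, 0 < t < T -> g t = g t} by apply: aeW.
have [_ H] := eq_ac_deriv ff' gg Hf; have [_ H'] := Hf'.
apply: (ae_imply2 H H') => t Ht Ht' tT.
by have [_ <-] := Ht tT; have [_ <-] := Ht' tT.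
Qed.

(** Trajectories require a measurable control that is bounded at every time;
    truncating a measurable derivative gives one. *)
Lemma ac_deriv_bounded_control T y g : 0 <= T -> ac_deriv T y g ->
  {ae mu, forall t, 0 < t < T -> `|g t| <= 1} ->
  exists u : R -> R, [/\ measurable_fun setT u, forall t, `|u t| <= 1,
    ac_deriv T y u & {ae mu, forall t, 0 < t < T -> g t = u t}].
Proof.
move=> T0 Hy g1; have [ay Hy'] := Hy.
have [|h [mh Hh _]] := abs_cont_measurable_derivative T0 ay.
  by apply: (ae_imply Hy') => t H /H[].
(* Truncation to [-1, 1] changes h on a null set only. *)
pose u t := Num.max (-1) (Num.min 1 (h t)).
have gu : {ae mu, forall t, 0 < t < T -> g t = u t}.
  have gh := ac_deriv_ae_unique Hy (conj ay Hh) (fun _ _ => erefl).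
  apply: (ae_imply2 gh g1) => t + + tT => /(_ tT) gh' /(_ tT).
  by rewrite ler_norml /u -gh' => /andP[h1 h2]; rewrite (min_idPr h2) (max_idPr h1).
exists u; split => //.
- by apply: measurable_maxr => //; apply: measurable_minr.
- move=> t; rewrite ler_norml /u le_max lexx ge_max ge_min lexx /= andbT; lra.
- exact: eq_ac_deriv gu Hy.
Qed.

Lemma ac_integral_half_sqr T (z0 : R) x : 0 <= T -> abs_cont 0 T x ->
  ac_deriv T (fun t => z0 + 2^-1 * \int[mu]_(s in `[0, t]) (x s) ^+ 2)
    (fun t => 2^-1 * x t ^+ 2).
Proof.
move=> T0 ax; have cx := abs_cont_continuous ax.
have i := continuous_itv_integrable (within_continuousM cx cx).
apply: eq_ac_deriv (ac_derivD (ac_deriv_cst T z0) (ac_derivZ 2^-1 (ac_integral T0 i))).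
  by [].
by apply: aeW => t _; rewrite add0r.
Qed.

Variables (T TF0 TF1 x0 y0 z0 w0 x1 y1 z1 w1 : R) (xa ya ua xb yb ub : R -> R).
Hypotheses (TF0_ge0 : 0 <= TF0) (TF1_ge0 : 0 <= TF1) (TFT : TF0 + TF1 <= T).
Hypotheses (opta : fuller_inf_optimal x0 y0 xa ya ua)
  (za : forall t, TF0 <= t -> [/\ xa t = 0, ya t = 0 & ua t = 0]).
Hypotheses (optb : fuller_inf_optimal x1 (- y1) xb yb ub)
  (zb : forall t, TF1 <= t -> [/\ xb t = 0, yb t = 0 & ub t = 0]).
Hypotheses (hz : (z1 - z0)%:E = (J_F x0 y0 + J_F x1 (- y1))%E)
  (hw : w1 - w0 = T).
Variables (xF yF uF : R -> R).
Hypothesis hF : fuller_optimal T x0 y0 x1 y1 xF yF uF.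

Let T0 : 0 <= T. Proof. exact: le_trans (addr_ge0 TF0_ge0 TF1_ge0) TFT. Qed.
Let minimal := fuller_feasible_minimal TF0_ge0 TF1_ge0 TFT opta za optb zb.
Let X t := xa t + xb (T - t).

Let xF_X t : 0 <= t <= T -> xF t = X t.
Proof.
apply: minimal hF.1 _ _; rewrite -(concatenation_cost TF0_ge0 TF1_ge0 TFT opta za optb zb).
exact: hF.2 (concatenation_feasible TF0_ge0 TF1_ge0 TFT opta za optb zb).
Qed.

Lemma optimal_cost : fuller_cost `[0, T] xF = (z1 - z0)%:E.
Proof.
rewrite hz -(concatenation_cost TF0_ge0 TF1_ge0 TFT opta za optb zb).
rewrite /fuller_cost; congr (_ * _)%E; apply: eq_integral => t.
by rewrite inE/= in_itv/= => /xF_X ->.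
Qed.

Lemma feasible_unique x y u : fuller_feasible T x0 y0 x1 y1 x y u ->
  fuller_cost `[0, T] x = (z1 - z0)%:E ->
  (forall t, 0 <= t <= T -> x t = xF t /\ y t = yF t) /\
  {ae mu, forall t, 0 < t < T -> u t = uF t}.
Proof.
move=> Hx cost.
have xxF t : 0 <= t <= T -> x t = xF t.
  move=> tT; rewrite xF_X//; apply: (minimal Hx) => //.
  by rewrite cost hz.
have [[_ _ xy yu [_ y_0]] [_ y_T]] := Hx.
have [[_ _ xyF yuF [_ yF_0]] [_ yF_T]] := hF.1.
have yy_ae := ac_deriv_ae_unique xy xyF xxF.
have yyF t : 0 <= t <= T -> y t = yF t.
  move=> /andP[]; rewrite le_eqVlt => /predU1P[<- _|t0]; first by rewrite y_0 yF_0.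
  rewrite le_eqVlt => /predU1P[->|tT]; first by rewrite y_T yF_T.
  apply/eqP; rewrite -subr_eq0; apply/eqP.
  apply: (abs_cont_eq0 (abs_contB yu.1 yuF.1)); last by rewrite t0.
  by apply: (ae_imply yy_ae) => s ys sT; rewrite ys// subrr.
split; first by move=> t tT; rewrite xxF ?yyF.
exact: ac_deriv_ae_unique yu yuF yyF.
Qed.

Let zF t := z0 + 2^-1 * \int[mu]_(s in `[0, t]) (xF s) ^+ 2.

Lemma zF_ends : zF 0 = z0 /\ zF T = z1.
Proof.
split; first by rewrite /zF set_itv1 Rintegral_set1 mulr0 addr0.
have ax := fuller_traj_abs_cont hF.1.1.
have := optimal_cost; rewrite fuller_cost_finite; last exact: abs_cont_continuous.
by move=> [cost]; rewrite /zF; under eq_Rintegral do rewrite expr2; rewrite cost; ring.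
Qed.

(** Since w gains T in time T at rate at most 1, its rate is 1 almost everywhere.
    The system then reduces to the double integrator with z accumulating the
    cost, and the end value of z makes that cost minimal. *)
Lemma curve_rigidity (x y z w gx gy gz gw : R -> R) :
  ac_deriv T x gx -> ac_deriv T y gy -> ac_deriv T z gz -> ac_deriv T w gw ->
  {ae mu, forall t, 0 < t < T -> [/\ `|gy t| <= 1, `|gw t| <= 1,
    gx t = gw t * y t & gz t = gw t * (2^-1 * x t ^+ 2)]} ->
  [/\ x 0 = x0, y 0 = y0, z 0 = z0 & w 0 = w0] ->
  [/\ x T = x1, y T = y1, z T = z1 & w T = w1] ->
  (forall t, 0 <= t <= T ->
    [/\ x t = xF t, y t = yF t, z t = zF t & w t = w0 + t]) /\
  {ae mu, forall t, 0 < t < T -> gy t = uF t /\ gw t = 1}.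
Proof.
move=> Hx Hy Hz Hw ae [x_0 y_0 z_0 w_0] [x_T y_T z_T w_T].
have wE t : 0 <= t <= T -> w t = w0 + t.
  move=> /andP[t0 tT].
  have gw1 : {ae mu, forall t, 0 < t < T -> gw t <= 1}.
    apply: (ae_imply ae) => s H /H[_ + _ _]; apply: le_trans; exact: ler_norm.
  have := ac_deriv_ge Hw gw1 (lexx 0) t0 tT.
  have := ac_deriv_ge Hw gw1 t0 tT (lexx T).
  rewrite w_0 w_T; move: hw => hw' h1 h2; lra.
have gw1 : {ae mu, forall t, 0 < t < T -> gw t = 1}.
  apply: (ac_deriv_ae_unique Hw (f' := fun t => w0 + t) (g' := fun=> 1)) => //.
  split.
    apply: (@lipschitz_abs_cont _ _ _ 1) => s t _ st _.
    by rewrite mul1r ger0_norm; lra.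
  apply: aeW => t _; rewrite -[X in is_derive _ _ _ X]add0r; exact: is_deriveD.
have Hxy : ac_deriv T x y.
  apply: eq_ac_deriv Hx => //; apply: (ae_imply2 ae gw1) => t H H1 tT.
  by have [_ _ -> _] := H tT; rewrite H1// mul1r.
have gy1 : {ae mu, forall t, 0 < t < T -> `|gy t| <= 1}.
  by apply: (ae_imply ae) => t H /H[].
have [u [mu_ u1 Hyu gyu]] := ac_deriv_bounded_control T0 Hy gy1.
have Hxyu : fuller_feasible T x0 y0 x1 y1 x y u.
  split => //; split => //; exact: measurable_funS mu_.
have ax := Hx.1.
have zE t : 0 <= t <= T -> z t = z0 + 2^-1 * \int[mu]_(s in `[0, t]) (x s) ^+ 2.
  apply: (ac_deriv_unique (f' := fun t => z0 + 2^-1 * \int[mu]_(s in `[0, t]) (x s) ^+ 2) (g := gz) Hz); last first.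
    by rewrite set_itv1 Rintegral_set1 mulr0 addr0.
  apply: eq_ac_deriv (ac_integral_half_sqr z0 T0 ax) => //.
  apply: (ae_imply2 ae gw1) => s H H1 sT.
  by have [_ _ _ ->] := H sT; rewrite H1// mul1r.
have cost : fuller_cost `[0, T] x = (z1 - z0)%:E.
  rewrite fuller_cost_finite; last exact: abs_cont_continuous.
  congr (_%:E); rewrite -z_T zE ?T0 ?lexx//.
  by under [in RHS]eq_Rintegral do rewrite expr2; ring.
have [xyE uE] := feasible_unique Hxyu cost.
split.
  move=> t tT; have [xE yE] := xyE t tT; split => //; last exact: wE.
  rewrite zE// /zF; congr (_ + _ * _); apply: eq_Rintegral => s.
  rewrite inE/= in_itv/= => /andP[s0 st]; have /andP[_ tT'] := tT.
  by have [->] := xyE s ltac:(by rewrite s0 (le_trans st)).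
apply: (ae_imply2 gw1 (ae_imply2 gyu uE (fun t => @conj _ _))) => t H [H1 H2] tT.
by rewrite H// H1// H2.
Qed.

End Rigidity.

(** * The shortest path *)

Section ControlCurves.
Context {R : realType}.
Local Notation mu := (@lebesgue_measure R).

Lemma control_traj_curve (q0 q1 : 'rV[R]_4) (T : R) (c : R -> 'rV[R]_4)
    (u v : R -> R) : control_traj q0 q1 T c u v ->
  ac_curve q0 q1 T c /\ {ae mu, forall t : R, 0 < t < T ->
    (sf_norm (c t) (velocity c t) <= 1%:E)%E}.
Proof.
move=> [T0 _ uv1 Hc ends]; split.
  split => // j; have := ac_deriv_derive1 (Hc j); apply: eq_ac_deriv => //.
  by apply: aeW => t _; rewrite mxE.
have H j := (Hc j).2.
have vel : {ae mu, forall t, 0 < t < T -> velocity c t = horizontal (c t) (u t) (v t)}.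
  have E j : {ae mu, forall t, 0 < t < T -> velocity c t 0 j = horizontal (c t) (u t) (v t) 0 j}.
    by apply: (ae_imply (H j)) => t /[apply] -[_ <-]; rewrite mxE derive1E.
  apply: (ae_imply2 (ae_imply2 (E 0) (E 1) (fun t => @conj _ _))
    (ae_imply2 (E 2) (E 3) (fun t => @conj _ _))) => t [E0 E1] [E2 E3] tT.
  by apply/rowP; apply: ord4_ind; [exact: E0|exact: E1|exact: E2|exact: E3].
apply: (ae_imply vel) => t + tT => /(_ tT) ->.
have [|u1 v1] := uv1 t; first by case/andP: tT => *; rewrite !ltW.
exact: sf_norm_horizontal.
Qed.

Lemma control_traj_time_ge (q0 q1 : 'rV[R]_4) (T : R) (c : R -> 'rV[R]_4)
    (u v : R -> R) : control_traj q0 q1 T c u v -> q1 0 3 - q0 0 3 <= T.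
Proof.
move=> [T0 _ uv1 Hder [c0 c1]].
have v1 : {ae mu, forall t, 0 < t < T ->
    (v t *: f1 (c t) + u t *: f2 (c t)) 0 3 <= 1}.
  apply: aeW => t /andP[s0 sT]; rewrite -/(horizontal _ _ _) horizontalE.
  by apply: le_trans (ler_norm _) _; apply: (uv1 _ _).2; rewrite !ltW.
have := ac_deriv_ge (Hder 3) v1 (lexx 0) T0 (lexx T).
by rewrite c0 c1 subr0 mul1r.
Qed.

End ControlCurves.

Theorem theorem2 (R : realType) (x0 y0 z0 w0 x1 y1 z1 w1 TF0 TF1 : R)
    (hTF0 : is_T_F x0 y0 TF0) (hTF1 : is_T_F x1 (- y1) TF1)
    (hz : (z1 - z0)%:E = (J_F x0 y0 + J_F x1 (- y1))%E)
    (hw : TF0 + TF1 <= w1 - w0)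
    (xF yF uF : R -> R)
    (hF : fuller_optimal (w1 - w0) x0 y0 x1 y1 xF yF uF) :
  let t1 := w1 - w0 in
  let q0 := pt x0 y0 z0 w0 in
  let q1 := pt x1 y1 z1 w1 in
  let zF := fun t : R =>
    z0 + 2^-1 * \int[@lebesgue_measure R]_(s in `[0, t]) (xF s) ^+ 2 in
  let wF := fun t : R => w0 + t in
  let vF := fun _ : R => 1 in
  let qF := fun t : R => pt (xF t) (yF t) (zF t) (wF t) in
  (sf_shortest q0 q1 t1 qF /\
   forall (T : R) (c : R -> 'rV[R]_4), sf_shortest q0 q1 T c ->
     T = t1 /\ forall t, 0 <= t <= t1 -> c t = qF t) /\
  (time_optimal q0 q1 t1 qF uF vF /\
   forall (T : R) (c : R -> 'rV[R]_4) (u v : R -> R),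
     time_optimal q0 q1 T c u v ->
     [/\ T = t1, forall t, 0 <= t <= t1 -> c t = qF t &
         {ae (@lebesgue_measure R),
           forall t : R, 0 <= t <= t1 -> u t = uF t /\ v t = vF t}]).
Proof.
move=> t1 q0 q1 zF wF vF qF.
have [TF0_ge0 [xa [ya [ua [opta za _]]]]] := hTF0.
have [TF1_ge0 [xb [yb [ub [optb zb _]]]]] := hTF1.
have t10 : 0 <= t1 by exact: le_trans (addr_ge0 TF0_ge0 TF1_ge0) hw.
have rigid := curve_rigidity TF0_ge0 TF1_ge0 hw opta za optb zb hz erefl hF.
have [zF0 zF1] : zF 0 = z0 /\ zF t1 = z1 :=
  zF_ends TF0_ge0 TF1_ge0 hw opta za optb zb hz hF.
have [[[muF uF1 xyF yuF [xF0 yF0]] [xF1 yF1]] _] := hF.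
have qF_traj : control_traj q0 q1 t1 qF uF vF.
  split => //.
  - by split => //; exact: measurable_cst.
  - by move=> t tT; rewrite /vF normr1; split => //; exact: uF1.
  - have eqae f g g' : (forall t, g t = g' t) -> ac_deriv t1 f g -> ac_deriv t1 f g'.
      by move=> gg; apply: eq_ac_deriv => //; apply: aeW => t _.
    have hE t j : (vF t *: f1 (qF t) + uF t *: f2 (qF t)) 0 j =
      horizontal (qF t) (uF t) (vF t) 0 j by [].
    apply: ord4_ind.
    + apply: (eqae _ yF); first by move=> t; rewrite hE horizontalE ptE mul1r.
      by apply: eq_ac_deriv xyF => [t _|]; [rewrite ptE|apply: aeW].
    + apply: (eqae _ uF); first by move=> t; rewrite hE horizontalE.
      by apply: eq_ac_deriv yuF => [t _|]; [rewrite ptE|apply: aeW].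
    + apply: (eqae _ (fun t => 2^-1 * xF t ^+ 2)).
        by move=> t; rewrite hE horizontalE ptE mul1r.
      have := ac_integral_half_sqr z0 t10 xyF.1.
      by apply: eq_ac_deriv => [t _|]; [rewrite ptE|apply: aeW].
    + apply: (eqae _ (fun=> 1)); first by move=> t; rewrite hE horizontalE.
      split.
        apply: (@lipschitz_abs_cont _ _ _ 1) => s t _ st _.
        by rewrite !ptE /wF mul1r ger0_norm; lra.
      apply: aeW => t _; rewrite (_ : (fun t => _) = wF).
        rewrite -[X in is_derive _ _ _ X]add0r; exact: is_deriveD.
      by apply/funext => s; rewrite ptE.
  - split.
      by rewrite /qF xF0 yF0 zF0 /wF addr0.
    by rewrite /qF xF1 yF1 zF1 /wF /t1 addrC subrK.
(* The infimum of lengths is attained by the lift, since w cannot gain t1 at a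
   smaller length. *)
have dist_t1 : sf_dist q0 q1 = t1%:E.
  apply/eqP; rewrite eq_le; apply/andP; split.
    have [Hc Hn] := control_traj_curve qF_traj.
    apply: le_trans (integral_le_itv_length t10 _ Hn).
      by apply: ereal_inf_lbound; exists t1, qF.
    by move=> t; exact: sf_norm_ge0.
  apply: le_ereal_inf_tmp => _ [T [c [Hc ->]]].
  by have := sf_length_ge Hc; rewrite !ptE.
have ends (c : R -> 'rV[R]_4) : c 0 = q0 -> c t1 = q1 ->
    [/\ c 0 0 0 = x0, c 0 0 1 = y0, c 0 0 2 = z0 & c 0 0 3 = w0] /\
    [/\ c t1 0 0 = x1, c t1 0 1 = y1, c t1 0 2 = z1 & c t1 0 3 = w1].
  by move=> -> ->; rewrite !ptE.
split; split.
- by have [? ?] := control_traj_curve qF_traj; split.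
- move=> T c [Hc Hn]; rewrite dist_t1 => -[TE]; rewrite {}TE in Hc Hn *.
  split => //; have [_ Hder [c0 c1]] := Hc.
  have [e0 e1] := ends c c0 c1.
  have [] := rigid _ _ _ _ _ _ _ _ (Hder 0) (Hder 1) (Hder 2) (Hder 3) _ e0 e1.
    apply: (ae_imply Hn) => t /[apply] /sf_norm_le1[h1 h3 hE]; split => //.
      by rewrite {1}hE horizontalE.
    by rewrite {1}hE horizontalE.
  by move=> H _ t tT; have [h0 h1 h2 h3] := H t tT; exact: pt_eq.
- split => // T c u v /control_traj_time_ge.
  by rewrite /q0 /q1 !ptE.
- move=> T c u v [Hc opt].
  have TE : T = t1.
    have := control_traj_time_ge Hc; rewrite !ptE -/t1 => t1T.
    by apply/eqP; rewrite eq_le t1T (opt _ _ _ _ qF_traj).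
  rewrite {}TE in Hc opt *; have [_ _ uv1 Hder [c0 c1]] := Hc.
  have [e0 e1] := ends c c0 c1.
  have [] := rigid _ _ _ _ _ _ _ _ (Hder 0) (Hder 1) (Hder 2) (Hder 3) _ e0 e1.
    apply: aeW => t /andP[s0 sT]; rewrite -/(horizontal _ _ _) !horizontalE.
    by have [|u1 v1] := uv1 t; first by rewrite !ltW.
  move=> H Hae; split => //.
    by move=> t tT; have [h0 h1 h2 h3] := H t tT; exact: pt_eq.
  apply: ae_closed_itv; apply: (ae_imply Hae) => t /[apply].
  by rewrite -/(horizontal _ _ _) !horizontalE.
Qed.
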